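(* There is a polynomial time algorithm which, on input $\Gamma$, a finite set of ground term equations, and $t$, a ground term, outputs the size of the $\sim_\Gamma$-congruence class of $t$ (possibly $\infty$).
   Context: $\Sigma$ is a finite functional signature having function symbols (of positive arity) and constant symbols. A ground term is a term built only from constants and function symbols of $\Sigma$; $\mathcal{F}$ is the algebra of all ground terms. A ground term equation is an expression $p=q$ with $p,q$ ground terms. For a finite set $\Gamma$ of ground term equations, $\sim_\Gamma$ is the congruence on $\mathcal{F}$ given by $p\sim_\Gamma q$ iff $\Gamma\vdash p=q$ (equivalently, the smallest congruence on $\mathcal{F}$ containing all pairs $(p,q)$ with $p=q$ in $\Gamma$). The size of the $\sim_\Gamma$-congruence class of $t$ is the number of ground terms $s$ with $s\sim_\Gamma t$, or $\infty$ if there are infinitely many. The size $|t|$ of a ground term $t$ is the number of nodes of its syntax tree, and $|\Gamma|=\sum_{(p=q)\in\Gamma}(|p|+|q|)$. Polynomial time means polynomial in $|\Gamma|$ and $|t|$.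
   Formalization: Each sum or product of class sizes counts as one step, since a finite class size can be doubly exponential in the input and so cannot be written in binary in polynomial time; all other work, including deciding whether the size is infinite, is ordinary polynomial time. *)

(* Defs.v *)
From HB Require Import structures.
From mathcomp Require Import all_boot.
From mathcomp Require Import boolp classical_sets functions cardinality.

Set Implicit Arguments.
Unset Strict Implicit.
Unset Printing Implicit Defensive.

(** * Ground terms and ground equations *)

(** Constant symbols are the symbols of arity 0. *)
Record signature := Signature {
  symbol :> finType;
  arity : symbol -> nat }.

Inductive term (S : signature) : Type :=
  App (f : S) of {ffun 'I_(arity f) -> term S}.

HB.instance Definition _ (S : signature) := gen_eqMixin (term S).

Fixpoint term_size (S : signature) (t : term S) : nat :=
  let: App f a := t in (sumn [seq term_size (a i) | i : 'I_(arity f)]).+1.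

Definition equations_size (S : signature) (G : seq (term S * term S)) : nat :=
  \sum_(e <- G) (term_size e.1 + term_size e.2).

Inductive derivable (S : signature) (G : seq (term S * term S)) :
    term S -> term S -> Prop :=
| derivable_ax p q : (p, q) \in G -> derivable G p q
| derivable_refl p : derivable G p p
| derivable_sym p q : derivable G p q -> derivable G q p
| derivable_trans p q r : derivable G p q -> derivable G q r -> derivable G p r
| derivable_cong (f : S) (a b : {ffun 'I_(arity f) -> term S}) :
    (forall i, derivable G (a i) (b i)) -> derivable G (App a) (App b).

Definition congruence_class (S : signature) (G : seq (term S * term S))
    (t : term S) : set (term S) := [set s | derivable G s t]%classic.

(** Sizes in [nat] extended by infinity, the latter being [None]. *)
Definition has_size (T : Type) (A : set T) (n : option nat) : Prop :=
  if n is Some k then (A #= `I_k)%card else infinite_set A.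

(** * Machine model

    Structured programs for a random access machine, every elementary
    instruction and every test costing one step.  The registers [reg] and the
    memory [mem] hold machine words; words are only added, subtracted
    (truncated at 0), and tested for 0, so that a run of T steps on an input of
    n words, each at most n plus a constant, produces words of O(T + log n)
    bits only, and polynomial time on this part of the machine is polynomial
    time on Turing machines.

    The size of a finite congruence class can be doubly exponential in the size
    of the input: the class of g^n(a) modulo
    a = b, g^(i+1)(a) = f(g^i(a), g^i(a)) (i < n) has at least 2^(2^n)
    elements.  Its binary expansion then cannot be written in polynomial time,
    so sums and products of the computed sizes have to count as single steps.
    They live in a separate memory [num], whose contents can be neither tested
    nor moved to [reg] or [mem]: unit-cost multiplication yields no
    computational power beyond the arithmetic on the output. *)

Record state := State {
  reg : nat -> nat;
  mem : nat -> nat;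
  num : nat -> nat }.

Definition upd (m : nat -> nat) (i v : nat) : nat -> nat :=
  fun j => if j == i then v else m j.

Inductive instr : Type :=
| Const of nat & nat           (* reg x := n *)
| Add of nat & nat & nat       (* reg x := reg y + reg z *)
| Sub of nat & nat & nat       (* reg x := reg y - reg z *)
| Fetch of nat & nat           (* reg x := mem (reg y) *)
| Write of nat & nat           (* mem (reg x) := reg y *)
| NumConst of nat & nat        (* num (reg x) := n *)
| NumAdd of nat & nat & nat    (* num (reg x) := num (reg y) + num (reg z) *)
| NumMul of nat & nat & nat.   (* num (reg x) := num (reg y) * num (reg z) *)

Definition step (i : instr) (s : state) : state :=
  let: State r m c := s in
  match i with
  | Const x n => State (upd r x n) m c
  | Add x y z => State (upd r x (r y + r z)) m c
  | Sub x y z => State (upd r x (r y - r z)) m c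
  | Fetch x y => State (upd r x (m (r y))) m c
  | Write x y => State r (upd m (r x) (r y)) c
  | NumConst x n => State r m (upd c (r x) n)
  | NumAdd x y z => State r m (upd c (r x) (c (r y) + c (r z)))
  | NumMul x y z => State r m (upd c (r x) (c (r y) * c (r z)))
  end.

Inductive program : Type :=
| Skip
| Instr of instr
| Seq of program & program
| If of nat & program & program
| While of nat & program.

(** [exec c s T s']: started in [s], the program [c] halts in [s'] after exactly
    [T] steps. *)
Inductive exec : program -> state -> nat -> state -> Prop :=
| exec_Skip s : exec Skip s 1 s
| exec_Instr i s : exec (Instr i) s 1 (step i s)
| exec_Seq c1 c2 s1 s2 s3 T1 T2 :
    exec c1 s1 T1 s2 -> exec c2 s2 T2 s3 -> exec (Seq c1 c2) s1 (T1 + T2) s3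
| exec_If_then x c1 c2 s s' T :
    reg s x != 0 -> exec c1 s T s' -> exec (If x c1 c2) s T.+1 s'
| exec_If_else x c1 c2 s s' T :
    reg s x == 0 -> exec c2 s T s' -> exec (If x c1 c2) s T.+1 s'
| exec_While_stop x c s : reg s x == 0 -> exec (While x c) s 1 s
| exec_While_loop x c s1 s2 s3 T1 T2 :
    reg s1 x != 0 -> exec c s1 T1 s2 -> exec (While x c) s2 T2 s3 ->
    exec (While x c) s1 (T1 + T2).+1 s3.

(** The input occupies an initial segment of [mem], its length being in
    register 0. *)
Definition input (w : seq nat) : state :=
  State (upd (fun=> 0) 0 (size w)) (nth 0 w) (fun=> 0).

(** A program answers "infinite" by halting with a nonzero register 0. *)
Definition output (s : state) : option nat :=
  if reg s 0 == 0 then Some (num s 0) else None.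

Definition polynomial_time (X : Type) (encode : X -> seq nat) (measure : X -> nat)
    (spec : X -> option nat -> Prop) : Prop :=
  exists (c : program) (C k : nat), forall x : X, exists (T : nat) (s : state),
    [/\ exec c (input (encode x)) T s,
        T <= C * (measure x).+1 ^ k
      & spec x (output s)].

(** * Encoding of the input *)

(** Polish notation, one word for each node. *)
Fixpoint encode_term (S : signature) (t : term S) : seq nat :=
  let: App f a := t in
  nat_of_ord (enum_rank f) ::
    flatten [seq encode_term (a i) | i : 'I_(arity f)].

(** The number of equations, followed by the equations and the term. *)
Definition encode_input (S : signature)
    (x : seq (term S * term S) * term S) : seq nat :=
  size x.1 ::
    flatten [seq encode_term e.1 ++ encode_term e.2 | e <- x.1] ++
    encode_term x.2.

(* Main.v *)
(** Every term equivalent to a term occurring in the input has only such terms,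
    up to equivalence, as arguments.  Hence, if R labels the positions of the
    input by the classes of their subterms, the congruence is decided by a
    bottom-up tree automaton with the labels as states and one transition per
    class of congruent positions.

    The labelling is the limit of the propagation of the least label along the
    equations and between congruent positions: every round that changes
    something decreases the sum of the labels, so L * L rounds suffice on an
    input of L words.  The class of a position is infinite iff it has an element
    of height greater than L (the sets of positions whose class has an element
    of height greater than d decrease with d, so they are constant from d = L
    on); otherwise the number of its elements of height at most L, computed by
    the recursion on the transitions, is its size.

    All loops of the algorithm run exactly L times, so that its running time is
    polynomial for syntactic reasons. *)

From HB Require Import structures.
From mathcomp Require Import all_boot.
From mathcomp Require Import zify.
From mathcomp Require Import boolp classical_sets functions cardinality.
Require Import Defs.

Set Implicit Arguments.
Unset Strict Implicit.
Unset Printing Implicit Defensive.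

(** * Bounded loops on the machine *)

(** Only positive lengths count: there [L ^ k] grows with [k], which makes bounds easy to add, and
    an encoded input is never empty. *)
Definition polynomially_bounded (b : nat -> nat) : Prop :=
  exists C k, forall L, 0 < L -> b L <= C * L ^ k.

Lemma polynomially_bounded_cst n : polynomially_bounded (fun=> n).
Proof. by exists n, 0 => L _; rewrite expn0 muln1. Qed.

Lemma polynomially_bounded_id : polynomially_bounded id.
Proof. by exists 1, 1 => L _; rewrite expn1 mul1n. Qed.

Lemma polynomially_boundedD b1 b2 : polynomially_bounded b1 ->
  polynomially_bounded b2 -> polynomially_bounded (fun L => b1 L + b2 L).
Proof.
move=> [C1 [k1 H1]] [C2 [k2 H2]]; exists (C1 + C2), (maxn k1 k2) => L L0.
rewrite mulnDl leq_add //.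
  by apply: leq_trans (H1 _ L0) _; rewrite leq_mul2l leq_pexp2l ?leq_maxl ?orbT.
by apply: leq_trans (H2 _ L0) _; rewrite leq_mul2l leq_pexp2l ?leq_maxr ?orbT.
Qed.

Lemma polynomially_boundedM b1 b2 : polynomially_bounded b1 ->
  polynomially_bounded b2 -> polynomially_bounded (fun L => b1 L * b2 L).
Proof.
move=> [C1 [k1 H1]] [C2 [k2 H2]]; exists (C1 * C2), (k1 + k2) => L L0.
by rewrite expnD mulnACA leq_mul ?H1 ?H2.
Qed.

Ltac poly_bound := repeat first
  [ assumption | apply: polynomially_boundedD | apply: polynomially_boundedM
  | apply: polynomially_bounded_cst | apply: polynomially_bounded_id ].

(** Times are bounded from above rather than computed, so that both branches of a conditional can
    share one bound. *)
Definition runs (c : program) (s : state) (b : nat) (s' : state) : Prop :=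
  exists2 T, T <= b & exec c s T s'.

Lemma runs_le c s b b' s' : b <= b' -> runs c s b s' -> runs c s b' s'.
Proof. by move=> le_b [T leT ?]; exists T => //; apply: leq_trans le_b. Qed.

Lemma runs_Seq c1 c2 s1 s2 s3 b1 b2 : runs c1 s1 b1 s2 -> runs c2 s2 b2 s3 ->
  runs (Seq c1 c2) s1 (b1 + b2) s3.
Proof.
move=> [T1 le1 e1] [T2 le2 e2]; exists (T1 + T2); first exact: leq_add.
exact: exec_Seq e1 e2.
Qed.

Lemma runs_If_then x c1 c2 s s' b : reg s x != 0 -> runs c1 s b s' ->
  runs (If x c1 c2) s b.+1 s'.
Proof. by move=> ? [T ? ?]; exists T.+1 => //; apply: exec_If_then. Qed.

Lemma runs_If_else x c1 c2 s s' b : reg s x == 0 -> runs c2 s b s' ->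
  runs (If x c1 c2) s b.+1 s'.
Proof. by move=> ? [T ? ?]; exists T.+1 => //; apply: exec_If_else. Qed.

Definition block (l : seq instr) : program :=
  foldr (fun i c => Seq (Instr i) c) Skip l.

Lemma runs_block l s :
  runs (block l) s (size l).+1 (foldl (fun s i => step i s) s l).
Proof.
elim: l s => [|i l IH] s; first by exists 1 => //; constructor.
rewrite -[(size (i :: l)).+1]/(1 + (size l).+1).
by apply: runs_Seq (IH _); exists 1 => //; constructor.
Qed.

(** Frame condition: code whose first free register is [d] leaves the registers below [d] unchanged.
    It serves for the cells of [num] as well. *)
Definition agree (n : nat) (f g : nat -> nat) : Prop :=
  forall x, x < n -> g x = f x.

Lemma agree_trans n f g h : agree n f g -> agree n g h -> agree n f h.
Proof. by move=> fg gh x xn; rewrite gh // fg. Qed.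

Lemma agree_le n n' f g : n' <= n -> agree n f g -> agree n' f g.
Proof. by move=> le fg x xn; apply: fg; apply: leq_trans le. Qed.

Lemma agree_upd n f a v : n <= a -> agree n f (upd f a v).
Proof. by move=> le x xn; rewrite /upd; case: eqP => // ?; lia. Qed.

Lemma agree_updr n f g a v : n <= a -> agree n f g -> agree n f (upd g a v).
Proof. by move=> le /agree_trans; apply; apply: agree_upd. Qed.

Lemma agree_map n f g s : agree n f g -> all (fun x => x < n) s ->
  [seq g x | x <- s] = [seq f x | x <- s].
Proof. by move=> fg /allP sn; apply/eq_in_map => x /sn; apply: fg. Qed.

Lemma updE f a v : upd f a v a = v. Proof. by rewrite /upd eqxx. Qed.

Lemma updN f a v x : x != a -> upd f a v x = f x.
Proof. by rewrite /upd => /negbTE ->. Qed.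

Ltac upd_simpl := rewrite /= /upd;
  repeat (case: eqP => ?; try lia); try done; try lia.

(** Register 0 holds the number of iterations, and register [d.+1] the number of
    those that remain. *)
Definition for_loop (d : nat) (body : program) : program :=
  Seq (block [:: Const d 0; Sub d.+1 0 d])
    (While d.+1
      (Seq body (block [:: Const d.+1 1; Add d d d.+1; Sub d.+1 0 d]))).

(** The invariant has to survive changes of the registers from [d] on, because the loop control
    overwrites [d] and [d.+1]. The body may use [d.+1] as scratch, since the number of remaining
    rounds is recomputed from registers 0 and [d]. *)
Lemma runs_for_loop (L d b : nat) (body : program) (I : nat -> state -> Prop) s :
    0 < d ->
    (forall i s, I i s -> reg s 0 = L) ->
    (forall i r r' m c, I i (State r m c) -> agree d r r' -> I i (State r' m c)) ->
    (forall i s, i < L -> I i s -> reg s d = i ->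
      exists s', [/\ runs body s b s', I i.+1 s' & reg s' d = i]) ->
    I 0 s ->
  exists2 s', runs (for_loop d body) s (L * (b + 5) + 4) s' & I L s'.
Proof.
move=> d0 I0 Istab Ibody Is.
(* Induction on the number [k] of rounds left. A round costs [b] for the body, 4 for the control
   block and 1 for the test. *)
suff loop k i s0 : i + k = L -> I i s0 -> reg s0 d = i -> reg s0 d.+1 = k ->
    exists2 s', runs (While d.+1
      (Seq body (block [:: Const d.+1 1; Add d d d.+1; Sub d.+1 0 d])))
      s0 (k * (b + 5) + 1) s' & I L s'.
  have sL := I0 _ _ Is; case: s Is sL => r m c /= Is sL.
  have H := runs_block [:: Const d 0; Sub d.+1 0 d] (State r m c).
  set s0 := foldl _ _ _ in H.
  have [|||s' H' Is'] := loop L 0 s0 (add0n L); last exists s' => //.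
  - by apply: Istab Is _; do 2 (apply: agree_updr => //).
  - by upd_simpl.
  - by upd_simpl.
  by apply: runs_le (runs_Seq H H') => /=; lia.
elim: k i s0 => [|k IH] i s0 ik Is0 s0d s0d1.
  exists s0; last by rewrite -ik addn0.
  by exists 1 => //; apply: exec_While_stop; rewrite s0d1.
have iL : i < L by lia.
have [s1 [run1 Is1 s1d]] := Ibody _ _ iL Is0 s0d.
have s1L := I0 _ _ Is1; case: s1 run1 Is1 s1d s1L => r m c /= run1 Is1 s1d s1L.
have run2 := runs_block [:: Const d.+1 1; Add d d d.+1; Sub d.+1 0 d] (State r m c).
set s2 := foldl _ _ _ in run2.
have [||||s3 run3 Is3] := IH i.+1 s2.
- lia.
- by apply: Istab Is1 _; do 3 (apply: agree_updr => //).
- by upd_simpl.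
- by upd_simpl.
exists s3 => //; case: (runs_Seq run1 run2) => T1 /= le1 ex1.
case: run3 => T2 le2 ex2; exists (T1 + T2).+1; first by lia.
by apply: exec_While_loop ex1 ex2; rewrite s0d1.
Qed.

(** * Expressions *)

(** Variables are de Bruijn indices; a fold binds the loop index (index 0) and
    the accumulator (index 1), and an index out of range denotes [L]. *)
Inductive expr : Type :=
| Lit of nat
| Var of nat
| Plus of expr & expr
| Minus of expr & expr
| Arr of nat & expr
| Ite of expr & expr & expr
| Fold of expr & expr.

Fixpoint eval (L : nat) (A : nat -> nat -> nat) (rho : seq nat) (e : expr) : nat :=
  match e with
  | Lit n => n
  | Var x => nth L rho x
  | Plus e1 e2 => eval L A rho e1 + eval L A rho e2
  | Minus e1 e2 => eval L A rho e1 - eval L A rho e2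
  | Arr k e1 => A k (eval L A rho e1)
  | Ite e1 e2 e3 => if eval L A rho e1 != 0 then eval L A rho e2 else eval L A rho e3
  | Fold e0 e1 => iteri L (fun i acc => eval L A [:: i, acc & rho] e1) (eval L A rho e0)
  end.

(** Array number [k] occupies the addresses from [k.*2 * L] on; the [L]
    addresses from [L] on are a buffer. *)
Definition arr (L : nat) (m : nat -> nat) (k i : nat) : nat :=
  if i < L then m (k.*2 * L + i) else 0.

(** Words cannot be multiplied, so an offset [k * L] is produced by [k] additions of register 0. *)
Definition shift (d k : nat) : program := block (nseq k (Add d d 0)).

Lemma runs_shift d k r m c : 0 < d -> exists r',
  [/\ runs (shift d k) (State r m c) k.+1 (State r' m c),
      agree d r r' & r' d = r d + k * r 0].
Proof.
move=> d0; elim: k r => [|k IH] r.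
  exists r; split=> //; last by lia.
  by exists 1 => //; constructor.
have [r' [H ag Hd]] := IH (upd r d (r d + r 0)).
exists r'; split.
- rewrite -[k.+2]/(1 + k.+1); apply: runs_Seq H.
  by exists 1 => //; apply: exec_Instr.
- exact: agree_trans (agree_upd _ _ (leqnn d)) ag.
- by rewrite Hd; upd_simpl.
Qed.

(** [sg] lists the registers of the variables; the value goes to register [d], and those above are
    scratch. In a fold, [d] holds the accumulator, [d.+1] the index, and [d.+2] first the rounds
    left and then the value of the body. *)
Fixpoint compile (sg : seq nat) (d : nat) (e : expr) : program :=
  match e with
  | Lit n => block [:: Const d n]
  | Var x => block [:: Const d 0; Add d d (nth 0 sg x)]
  | Plus e1 e2 =>
      Seq (compile sg d e1) (Seq (compile sg d.+1 e2) (block [:: Add d d d.+1]))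
  | Minus e1 e2 =>
      Seq (compile sg d e1) (Seq (compile sg d.+1 e2) (block [:: Sub d d d.+1]))
  | Arr k e1 =>
      Seq (compile sg d e1) (Seq (block [:: Sub d.+1 0 d])
        (If d.+1 (Seq (shift d k.*2) (block [:: Fetch d d])) (block [:: Const d 0])))
  | Ite e1 e2 e3 => Seq (compile sg d e1) (If d (compile sg d e2) (compile sg d e3))
  | Fold e0 e1 =>
      Seq (compile sg d e0) (for_loop d.+1
        (Seq (compile [:: d.+1, d & sg] d.+2 e1)
          (block [:: Const d 0; Add d d d.+2])))
  end.

Lemma iteriSr T n (f : nat -> T -> T) x : iteri n.+1 f x = f n (iteri n f x).
Proof. by []. Qed.

(** The bound is fixed before [L] and the memory are known. It follows the syntax: a fold multiplies
    by [L], the other constructors only add. *)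
Lemma compile_correct e : exists2 b, polynomially_bounded b &
  forall L sg d r m c, r 0 = L -> 0 < d -> all (fun x => x < d) sg -> exists r',
    [/\ runs (compile sg d e) (State r m c) (b L) (State r' m c), agree d r r'
      & r' d = eval L (arr L m) [seq r x | x <- sg] e].
Proof.
elim: e => [n|x|e1 [b1 p1 IH1] e2 [b2 p2 IH2]|e1 [b1 p1 IH1] e2 [b2 p2 IH2]
  |k e1 [b1 p1 IH1]|e1 [b1 p1 IH1] e2 [b2 p2 IH2] e3 [b3 p3 IH3]
  |e1 [b1 p1 IH1] e2 [b2 p2 IH2]].
- exists (fun=> 2); first by poly_bound.
  move=> L sg d r m c r0 d0 sgd; eexists; split; first exact: (@runs_block [:: _]).
    exact: agree_upd.
  by upd_simpl.
- exists (fun=> 3); first by poly_bound.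
  move=> L sg d r m c r0 d0 sgd; eexists; split;
    first exact: (@runs_block [:: _; _]).
    by do 1 apply: agree_updr => //; apply: agree_upd.
  (* An index out of range selects register 0, whose content [L] is the default value in [eval]. *)
  have lt_d : nth 0 sg x < d.
    by have [xs|xs] := ltnP x (size sg); [apply: (allP sgd); rewrite mem_nth
                                       | rewrite nth_default].
  rewrite /= updE updE add0n updN ?neq_ltn ?lt_d //.
  have [xs|xs] := ltnP x (size sg); first by rewrite (nth_map 0).
  by rewrite !nth_default ?size_map.
- exists (fun L => b1 L + (b2 L + 2)); first by poly_bound.
  move=> L sg d r m c r0 d0 sgd.
  have [r1 [run1 ag1 E1]] := IH1 L sg d r m c r0 d0 sgd.
  have sgd1 : all (ltn^~ d.+1) sg by apply: sub_all sgd => y /=; lia.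
  have [|r2 [run2 ag2 E2]] := IH2 L sg d.+1 r1 m c _ isT sgd1; first by rewrite ag1.
  eexists; split.
  + apply: runs_Seq run1 _; apply: runs_Seq run2 _; exact: (@runs_block [:: _]).
  + apply: agree_updr => //; apply: agree_trans ag1 _; exact: agree_le ag2.
  + by rewrite /= updE E2 ag2 // E1 (agree_map ag1).
- exists (fun L => b1 L + (b2 L + 2)); first by poly_bound.
  move=> L sg d r m c r0 d0 sgd.
  have [r1 [run1 ag1 E1]] := IH1 L sg d r m c r0 d0 sgd.
  have sgd1 : all (ltn^~ d.+1) sg by apply: sub_all sgd => y /=; lia.
  have [|r2 [run2 ag2 E2]] := IH2 L sg d.+1 r1 m c _ isT sgd1; first by rewrite ag1.
  eexists; split.
  + apply: runs_Seq run1 _; apply: runs_Seq run2 _; exact: (@runs_block [:: _]).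
  + apply: agree_updr => //; apply: agree_trans ag1 _; exact: agree_le ag2.
  + by rewrite /= updE E2 ag2 // E1 (agree_map ag1).
- exists (fun L => b1 L + (2 + (k.*2 + 1 + 2 + 1))); first by poly_bound.
  move=> L sg d r m c r0 d0 sgd.
  have [r1 [run1 ag1 E1]] := IH1 L sg d r m c r0 d0 sgd.
  have r10 : r1 0 = L by rewrite ag1.
  pose r2 := upd r1 d.+1 (r1 0 - r1 d).
  have ag2 : agree d r r2 by apply: agree_updr => //.
  rewrite /= /arr -E1; case: ltnP => [lt|ge].
    have [r3 [run3 ag3 E3]] := runs_shift k.*2 r2 m c d0.
    eexists; split.
    + apply: runs_Seq run1 _; apply: runs_Seq (@runs_block [:: _] _) _.
      rewrite addn1; apply: runs_If_then; first by rewrite /= updE; lia.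
      apply: runs_Seq; first by rewrite addn1; exact: run3.
      exact: (@runs_block [:: _]).
    + by apply: agree_updr => //; apply: agree_trans ag2 ag3.
    + rewrite /= updE E3; congr (m _); rewrite /r2 !updN //; last by lia.
      by rewrite r10 addnC.
  eexists; split.
  + apply: runs_Seq run1 _; apply: runs_Seq (@runs_block [:: _] _) _.
    rewrite addn1; apply: runs_If_else; first by rewrite /= updE; lia.
    by apply: runs_le (@runs_block [:: _] _) => /=; lia.
  + by apply: agree_updr.
  + by rewrite /= updE.
- exists (fun L => b1 L + (b2 L + b3 L + 1)); first by poly_bound.
  move=> L sg d r m c r0 d0 sgd.
  have [r1 [run1 ag1 E1]] := IH1 L sg d r m c r0 d0 sgd.
  have r10 : r1 0 = L by rewrite ag1.
  rewrite /= -E1; case: ifP => [t|f].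
    have [r2 [run2 ag2 E2]] := IH2 L sg d r1 m c r10 d0 sgd.
    exists r2; split; last by rewrite E2 (agree_map ag1).
      apply: runs_Seq run1 _; rewrite addn1; apply: runs_If_then => //.
      by apply: runs_le run2; lia.
    exact: agree_trans ag2.
  have [r2 [run2 ag2 E2]] := IH3 L sg d r1 m c r10 d0 sgd.
  exists r2; split; last by rewrite E2 (agree_map ag1).
    apply: runs_Seq run1 _; rewrite addn1; apply: runs_If_else.
      by apply/negPn; rewrite /= f.
    by apply: runs_le run2; lia.
  exact: agree_trans ag2.
exists (fun L => b1 L + (L * (b2 L + 3 + 5) + 4)); first by poly_bound.
move=> L sg d r m c r0 d0 sgd.
have [r1 [run1 ag1 E1]] := IH1 L sg d r m c r0 d0 sgd.
pose g i acc := eval L (arr L m) [:: i, acc & [seq r x | x <- sg]] e2.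
pose I i s := exists r', [/\ s = State r' m c, agree d r r' & r' d = iteri i g (r1 d)].
have [|||||s' run2 [r2 [s'E ag2 E2]]] :=
    @runs_for_loop L d.+1 (b2 L + 3) (Seq (compile [:: d.+1, d & sg] d.+2 e2)
          (block [:: Const d 0; Add d d d.+2])) I (State r1 m c).
- by [].
- by move=> i _ [r' [-> ag _]] /=; rewrite ag.
- move=> i r' r'' m' c' [? [[-> -> ->] ag E]] ag'; exists r''; split=> //.
    exact: agree_trans ag (agree_le _ ag').
  by rewrite ag'.
- move=> i _ iL [r' [-> ag E]] /= r'i.
  have [|//||r2 [run2 ag2 E2]] := IH2 L [:: d.+1, d & sg] d.+2 r' m c.
  + by rewrite ag.
  + by rewrite /= !ltnS leqnn leqnSn /=; apply: sub_all sgd => y /=; lia.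
  eexists; split.
  + apply: runs_Seq run2 _; exact: (@runs_block [:: _; _]).
  + eexists; split; first by [].
      do 2 (apply: agree_updr => //); apply: agree_trans ag _.
      by apply: agree_le ag2; lia.
    rewrite /= updE updE add0n updN; last by lia.
    by rewrite E2 /= r'i E (agree_map ag) // -iteriSr.
  + by rewrite /= !updN ?ag2 //; lia.
- by exists r1.
subst s'; exists r2; split; first exact: runs_Seq run1 run2.
  exact: agree_le ag2.
by rewrite E2 E1.
Qed.

(** * Expressions over the output memory *)

(** Conditions and indices are word expressions, because the contents of [num] can be neither tested
    nor used as addresses. *)
Inductive nexpr : Type :=
| NLit of nat
| NArr of expr
| NMul of nexpr & nexpr
| NIte of expr & nexpr & nexpr
| NSum of nexpr.

Fixpoint neval (L : nat) (A : nat -> nat -> nat) (N : nat -> nat) (rho : seq nat)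
    (e : nexpr) : nat :=
  match e with
  | NLit n => n
  | NArr e1 => N (eval L A rho e1)
  | NMul e1 e2 => neval L A N rho e1 * neval L A N rho e2
  | NIte e1 e2 e3 =>
      if eval L A rho e1 != 0 then neval L A N rho e2 else neval L A N rho e3
  | NSum e1 => \sum_(i < L) neval L A N ((i : nat) :: rho) e1
  end.

(** In [num], the addresses below [L] hold an array, the next [L] ones a buffer,
    and those from [2 * L] on a stack of intermediate results. *)
Definition narr (L : nat) (c : nat -> nat) (i : nat) : nat := if i < L then c i else 0.

Lemma narr_agree L n c c' : L <= n -> agree n c c' -> narr L c' = narr L c.
Proof.
move=> Ln cc'; apply/funext => i; rewrite /narr; case: ltnP => // iL.
by apply: cc'; lia.
Qed.

Definition slot (d h : nat) : seq instr := [:: Const d h; Add d d 0; Add d d 0].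

(** The result is left in stack cell [h], at address [2 * L + h]; the cells above are scratch. There
    is no copy instruction on [num]: a value is moved by adding it to a cell set to 0. *)
Fixpoint ncompile (sg : seq nat) (d h : nat) (e : nexpr) : program :=
  match e with
  | NLit n => block (slot d h ++ [:: NumConst d n])
  | NArr e1 =>
      Seq (compile sg d e1) (Seq (block (slot d.+1 h ++
          [:: NumConst d.+1 0; Sub d.+2 0 d]))
        (If d.+2 (block [:: NumAdd d.+1 d.+1 d]) Skip))
  | NMul e1 e2 =>
      Seq (ncompile sg d h e1) (Seq (ncompile sg d h.+1 e2)
        (block (slot d h ++ slot d.+1 h.+1 ++ [:: NumMul d d d.+1])))
  | NIte e1 e2 e3 =>
      Seq (compile sg d e1) (If d (ncompile sg d h e2) (ncompile sg d h e3))
  | NSum e1 =>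
      Seq (block (slot d h ++ [:: NumConst d 0])) (for_loop d
        (Seq (ncompile (d :: sg) d.+1 h.+1 e1)
          (block (slot d.+1 h ++ slot d.+2 h.+1 ++ [:: NumAdd d.+1 d.+1 d.+2]))))
  end.

Lemma runs_slot d h r m c l : 0 < d ->
  exists r', [/\ foldl (fun s i => step i s) (State r m c) (slot d h ++ l) =
                 foldl (fun s i => step i s) (State r' m c) l,
    agree d r r' & r' d = 2 * r 0 + h].
Proof.
move=> d0; eexists; split; first by [].
  by do 3 (apply: agree_updr; [lia|]).
by upd_simpl.
Qed.

(** The second frame condition protects the array, the buffer and the stack cells below [h], so that
    the first factor of a product survives the evaluation of the second. *)
Lemma ncompile_correct e : exists2 b, polynomially_bounded b &
  forall L sg d h r m c, r 0 = L -> 0 < d -> all (fun x => x < d) sg -> exists r' c',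
    [/\ runs (ncompile sg d h e) (State r m c) (b L) (State r' m c'), agree d r r',
        agree (2 * L + h) c c'
      & c' (2 * L + h) = neval L (arr L m) (narr L c) [seq r x | x <- sg] e].
Proof.
elim: e => [n|e1|e1 [b1 p1 IH1] e2 [b2 p2 IH2]|e1 e2 [b2 p2 IH2] e3 [b3 p3 IH3]
  |e1 [b1 p1 IH1]].
- exists (fun=> 5); first by poly_bound.
  move=> L sg d h r m c r0 d0 sgd.
  have [r1 [E1 ag1 r1d]] := runs_slot h r m c [:: NumConst d n] d0.
  exists r1, (upd c (2 * L + h) n); split=> //.
  + have := @runs_block (slot d h ++ [:: NumConst d n]) (State r m c).
    by rewrite E1 /= r1d r0.
  + exact: agree_upd.
  + by rewrite updE.
- have [b1 p1 H1] := compile_correct e1.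
  exists (fun L => b1 L + (6 + 3)); first by poly_bound.
  move=> L sg d h r m c r0 d0 sgd.
  have [r1 [run1 ag1 E1]] := H1 L sg d r m c r0 d0 sgd.
  pose l := [:: NumConst d.+1 0; Sub d.+2 0 d].
  have [r2 [E2 ag2 r2d]] := runs_slot h r1 m c l (ltn0Sn d).
  have run2 := @runs_block (slot d.+1 h ++ l) (State r1 m c).
  rewrite E2 /= r2d ag1 // r0 !ag2 // in run2.
  set r3 := upd r2 _ _ in run2; set c3 := upd c _ _ in run2.
  have ag3 : agree d r r3.
    by apply: agree_updr; [lia|]; apply: agree_trans ag1 _; apply: agree_le ag2.
  have c3c : agree (2 * L + h) c c3 by apply: agree_upd.
  rewrite /= -E1 /narr; case: ltnP => [lt|ge].
    exists r3, (upd c3 (2 * L + h) (c3 (2 * L + h) + c3 (r1 d))); split=> //.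
    + apply: runs_Seq run1 _; apply: runs_Seq run2 _; apply: runs_If_then.
        by rewrite /= /r3 updE ag1 //; lia.
      have := @runs_block [:: NumAdd d.+1 d.+1 d] (State r3 m c3).
      have -> : r1 d = r3 d by rewrite /r3 updN ?ag2 //; lia.
      have <- : r3 d.+1 = 2 * L + h by rewrite /r3 updN ?r2d ?ag1 ?r0 //; lia.
      exact.
    + by apply: agree_updr.
    + by rewrite updE /c3 updE add0n updN //; lia.
  exists r3, c3; split=> //; last by rewrite /c3 updE.
  apply: runs_Seq run1 _; apply: runs_Seq run2 _; apply: runs_If_else.
    by rewrite /= /r3 updE ag1 //; lia.
  by exists 1 => //; constructor.
- exists (fun L => b1 L + (b2 L + 8)); first by poly_bound.
  move=> L sg d h r m c r0 d0 sgd.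
  have [r1 [c1 [run1 ag1 cg1 E1]]] := IH1 L sg d h r m c r0 d0 sgd.
  have [|r2 [c2 [run2 ag2 cg2 E2]]] := IH2 L sg d h.+1 r1 m c1 _ d0 sgd.
    by rewrite ag1.
  have r20 : r2 0 = L by rewrite ag2 // ag1.
  pose l := slot d.+1 h.+1 ++ [:: NumMul d d d.+1].
  have [r3 [E3 ag3 r3d]] := runs_slot h r2 m c2 l d0.
  have [r4 [E4 ag4 r4d]] := runs_slot h.+1 r3 m c2 [:: NumMul d d d.+1] (ltn0Sn d).
  have run3 := @runs_block (slot d h ++ l) (State r2 m c2).
  rewrite E3 E4 /= r4d ag4 // r3d ag3 // r20 in run3.
  exists r4; eexists; split.
  + by apply: runs_Seq run1 _; apply: runs_Seq run2 _; apply: run3.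
  + apply: agree_trans ag1 _; apply: agree_trans ag2 _; apply: agree_trans ag3 _.
    exact: agree_le ag4.
  + apply: agree_updr; [lia|]; apply: agree_trans cg1 _.
    by apply: agree_le cg2; lia.
  + rewrite updE E2 cg2 ?E1; last by lia.
    by rewrite (agree_map ag1) // (narr_agree _ cg1) //; lia.
- have [b1 p1 H1] := compile_correct e1.
  exists (fun L => b1 L + (b2 L + b3 L + 1)); first by poly_bound.
  move=> L sg d h r m c r0 d0 sgd.
  have [r1 [run1 ag1 E1]] := H1 L sg d r m c r0 d0 sgd.
  have r10 : r1 0 = L by rewrite ag1.
  rewrite /= -E1; case: ifP => [t|f].
    have [r2 [c2 [run2 ag2 cg2 E2]]] := IH2 L sg d h r1 m c r10 d0 sgd.
    exists r2, c2; split=> //; last by rewrite E2 (agree_map ag1).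
      apply: runs_Seq run1 _; rewrite addn1; apply: runs_If_then => //.
      by apply: runs_le run2; lia.
    exact: agree_trans ag2.
  have [r2 [c2 [run2 ag2 cg2 E2]]] := IH3 L sg d h r1 m c r10 d0 sgd.
  exists r2, c2; split=> //; last by rewrite E2 (agree_map ag1).
    apply: runs_Seq run1 _; rewrite addn1; apply: runs_If_else.
      by apply/negPn; rewrite /= f.
    by apply: runs_le run2; lia.
  exact: agree_trans ag2.
exists (fun L => 5 + (L * (b1 L + 8 + 5) + 4)); first by poly_bound.
move=> L sg d h r m c r0 d0 sgd.
have [r1 [E1 ag1 r1d]] := runs_slot h r m c [:: NumConst d 0] d0.
have run1 := @runs_block (slot d h ++ [:: NumConst d 0]) (State r m c).
rewrite E1 /= r1d r0 in run1.
set c1 := upd c _ _ in run1.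
pose g (i : nat) := neval L (arr L m) (narr L c) (i :: [seq r x | x <- sg]) e1.
pose I i s := exists r' c', [/\ s = State r' m c', agree d r r',
   agree (2 * L + h) c c' & c' (2 * L + h) = \sum_(j < i) g j].
have [||||s' run2 [r2 [c2 [s'E ag2 cg2 E2]]]] := @runs_for_loop L d (b1 L + 8)
   (Seq (ncompile (d :: sg) d.+1 h.+1 e1)
      (block (slot d.+1 h ++ slot d.+2 h.+1 ++ [:: NumAdd d.+1 d.+1 d.+2]))) I
   (State r1 m c1) d0.
- by move=> i _ [r' [c' [-> ag _]]] /=; rewrite ag.
- move=> i r' r'' m' c' [? [? [[-> -> ->] ag cg E]]] ag'.
    exists r''; eexists; split=> //.
  exact: agree_trans ag (agree_le _ ag').
- move=> i _ iL [r' [c' [-> ag cg E]]] /= r'i.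
  have [|//||r2 [c2 [run2 ag2 cg2 E2]]] := IH1 L (d :: sg) d.+1 h.+1 r' m c'.
  + by rewrite ag.
  + by rewrite /= ltnSn /=; apply: sub_all sgd => y /=; lia.
  have r20 : r2 0 = L by rewrite ag2 // ag.
  pose l := slot d.+2 h.+1 ++ [:: NumAdd d.+1 d.+1 d.+2].
  have [r3 [E3 ag3 r3d]] := runs_slot h r2 m c2 l (ltn0Sn d).
  have [r4 [E4 ag4 r4d]] :=
    runs_slot h.+1 r3 m c2 [:: NumAdd d.+1 d.+1 d.+2] (ltn0Sn d.+1).
  have run3 := @runs_block (slot d.+1 h ++ l) (State r2 m c2).
  rewrite E3 E4 /= r4d ag4 // r3d ag3 // r20 in run3.
  have ag5 : agree d.+1 r' r4.
    apply: agree_trans ag2 _; apply: agree_trans ag3 _; exact: agree_le ag4.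
  eexists; split; first exact: runs_Seq run2 run3; last by rewrite /= ag5.
  exists r4; eexists; split; first by [].
  + by apply: agree_trans ag _; apply: agree_le ag5.
  + apply: agree_updr; [lia|]; apply: agree_trans cg _.
    by apply: agree_le cg2; lia.
  + rewrite updE E2 cg2 ?E; last by lia.
    rewrite big_ord_recr /= r'i (agree_map ag) // (narr_agree _ cg) //; lia.
- exists r1, c1; split=> //; first exact: agree_upd.
  by rewrite /c1 updE big_ord0.
by subst s'; exists r2, c2; split=> //; apply: runs_Seq run1 run2.
Qed.

(** * Array programs *)

Inductive cmd : Type :=
| Tab of nat & expr
| NTab of nexpr
| CSeq of cmd & cmd
| Repeat of cmd.

Fixpoint run (L : nat) (p : cmd) (AN : (nat -> nat -> nat) * (nat -> nat)) :=
  let: (A, N) := AN in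
  match p with
  | Tab k e =>
      (fun k' i => if k' == k then if i < L then eval L A [:: i] e else 0
                   else A k' i, N)
  | NTab e => (A, fun i => if i < L then neval L A N [:: i] e else 0)
  | CSeq p1 p2 => run L p2 (run L p1 AN)
  | Repeat p1 => iter L (run L p1) AN
  end.

(** The new array is built in the buffer since its entries depend on the old one. *)
Fixpoint ccompile (d : nat) (p : cmd) : program :=
  match p with
  | Tab k e =>
      Seq (for_loop d (Seq (compile [:: d] d.+1 e)
            (block [:: Const d.+2 0; Add d.+2 d.+2 d; Add d.+2 d.+2 0;
                       Write d.+2 d.+1])))
          (for_loop d (Seq (block [:: Const d.+2 0; Add d.+2 d.+2 d; Add d.+2 d.+2 0;
                       Fetch d.+1 d.+2; Const d.+2 0; Add d.+2 d.+2 d])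
            (Seq (shift d.+2 k.*2) (block [:: Write d.+2 d.+1]))))
  | NTab e =>
      Seq (for_loop d (Seq (ncompile [:: d] d.+1 0 e)
            (block (slot d.+1 0 ++ [:: Const d.+2 0; Add d.+2 d.+2 d;
              Add d.+2 d.+2 0; NumConst d.+2 0; NumAdd d.+2 d.+2 d.+1]))))
          (for_loop d (block [:: Const d.+1 0; Add d.+1 d.+1 d; Add d.+1 d.+1 0;
              NumConst d 0; NumAdd d d d.+1]))
  | CSeq p1 p2 => Seq (ccompile d p1) (ccompile d p2)
  | Repeat p1 => for_loop d (ccompile d.+1 p1)
  end.

Lemma arr_upd L m k i v : i < L -> arr L (upd m (k.*2 * L + i) v) =
  fun k' j => if (k' == k) && (j == i) then v else arr L m k' j.
Proof.
move=> iL; apply/funext => k'; apply/funext => j; rewrite /arr /upd.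
have [jL|jL] := ltnP j L; last by case: eqP => //= _; case: eqP => // ?; lia.
have [->|ne] /= := eqVneq k' k; first by rewrite eqn_add2l.
case: eqP => // E; case/eqP: ne.
have L0 : 0 < L by lia.
(* Both offsets are below [L], so division by [L] recovers the array number from the address. *)
by move/(congr1 (fun x => x %/ L)): E; rewrite !divnMDl // !divn_small //; lia.
Qed.

(** Arrays start at even multiples of [L], so none of them meets the block from [L] to [2 * L]. *)
Lemma arr_buffer L m i v : i < L -> arr L (upd m (L + i) v) = arr L m.
Proof.
move=> iL; apply/funext => k; apply/funext => j; rewrite /arr /upd.
by case: ltnP => // jL; case: eqP => // E; case: k E => [|k]; nia.
Qed.

Lemma ccompile_correct p : exists2 b, polynomially_bounded b &
  forall L d r m c, r 0 = L -> 0 < d -> exists r' m' c',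
    [/\ runs (ccompile d p) (State r m c) (b L) (State r' m' c'), agree d r r'
      & (arr L m', narr L c') = run L p (arr L m, narr L c)].
Proof.
elim: p => [k e|e|p1 [b1 pb1 IH1] p2 [b2 pb2 IH2]|p1 [b1 pb1 IH1]].
- have [b1 pb1 H1] := compile_correct e.
  exists (fun L => (L * (b1 L + 5 + 5) + 4) + (L * (7 + (k.*2.+1 + 2) + 5) + 4)).
    by poly_bound.
  move=> L d r m c r0 d0.
  pose g i := eval L (arr L m) [:: i] e.
  (* While the buffer is filled all arrays stay intact, so every entry is evaluated on the old
     ones. *)
  pose I1 i s := exists r' m', [/\ s = State r' m' c, agree d r r',
    arr L m' = arr L m & forall j, j < i -> m' (L + j) = g j].
  have [||||s1 run1 [r1 [m1 [s1E ag1 E1 F1]]]] := @runs_for_loop L d (b1 L + 5)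
    (Seq (compile [:: d] d.+1 e)
            (block [:: Const d.+2 0; Add d.+2 d.+2 d; Add d.+2 d.+2 0;
                       Write d.+2 d.+1])) I1 (State r m c) d0.
  + by move=> i _ [r' [m' [-> ag _ _]]] /=; rewrite ag.
  + move=> i r' r'' m' c' [? [? [[-> -> ->] ag E F]]] ag'.
    exists r''; eexists; split=> //.
    exact: agree_trans ag (agree_le _ ag').
  + move=> i _ iL [r' [m' [-> ag E F]]] /= r'i.
    have [|||r2 [run2 ag2 E2]] := H1 L [:: d] d.+1 r' m' c; rewrite ?ag //=.
      by rewrite ltnSn.
    have run3 := @runs_block [:: Const d.+2 0; Add d.+2 d.+2 d; Add d.+2 d.+2 0;
                       Write d.+2 d.+1] (State r2 m' c).
    rewrite /= r'i E in E2.
    rewrite /= in run3; set r3 := upd _ d.+2 _ in run3.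
    have ag3 : agree d.+2 r2 r3 by do 3 (apply: agree_updr; [lia|]).
    have r3d2 : r3 d.+2 = L + i.
      have r20 : r2 0 = L by rewrite ag2 // ag.
      have r2d : r2 d = i by rewrite ag2.
      by rewrite /r3; upd_simpl.
    rewrite r3d2 ag3 // E2 in run3.
    eexists; split; first exact: runs_Seq run2 run3; last first.
      by rewrite /= ag3 // ag2.
    exists r3; eexists; split; first by [].
    * apply: agree_trans ag _; apply: (@agree_trans _ _ r2).
        by apply: agree_le ag2.
      by apply: agree_le ag3; lia.
    * by rewrite arr_buffer.
    * move=> j jS; rewrite /upd eqn_add2l; case: eqP => [->//|?].
      by apply: F; lia.
  + by exists r, m; split.
  subst s1.
  (* Copying back: the entries below [i] are new, and the whole buffer is still available. *)
  pose I2 i s := exists r' m', [/\ s = State r' m' c, agree d r r',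
    arr L m' = fun k' j => (if (k' == k) && (j < i) then g j else arr L m k' j)
    & forall j, j < L -> m' (L + j) = g j].
  have [||||s2 run2 [r2 [m2 [s2E ag2 E2 F2]]]] := @runs_for_loop L d (7 + (k.*2.+1 + 2))
    (Seq (block [:: Const d.+2 0; Add d.+2 d.+2 d; Add d.+2 d.+2 0;
                       Fetch d.+1 d.+2; Const d.+2 0; Add d.+2 d.+2 d])
            (Seq (shift d.+2 k.*2) (block [:: Write d.+2 d.+1]))) I2 (State r1 m1 c) d0.
  + by move=> i _ [r' [m' [-> ag _ _]]] /=; rewrite ag.
  + move=> i r' r'' m' c' [? [? [[-> -> ->] ag E F]]] ag'.
    exists r''; eexists; split=> //.
    exact: agree_trans ag (agree_le _ ag').
  + move=> i _ iL [r' [m' [-> ag E F]]] /= r'i.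
    have run3 := @runs_block [:: Const d.+2 0; Add d.+2 d.+2 d; Add d.+2 d.+2 0;
                       Fetch d.+1 d.+2; Const d.+2 0; Add d.+2 d.+2 d] (State r' m' c).
    rewrite /= in run3; set r3 := upd _ _ _ in run3.
    have r3v : [/\ r3 0 = L, r3 d = i, r3 d.+1 = g i & r3 d.+2 = i].
      have r'0 : r' 0 = L by rewrite ag.
      have F' : m' (0 + i + L) = g i by rewrite add0n addnC F.
      by rewrite /r3; split; upd_simpl; rewrite r'i r'0.
    have ag3 : agree d.+1 r' r3 by do 6 (apply: agree_updr; [lia|]).
    case: r3v => r30 r3d r3d1 r3d2.
    have [r4 [run4 ag4 r4d]] := runs_shift k.*2 r3 m' c (ltn0Sn d.+1).
    have run5 := @runs_block [:: Write d.+2 d.+1] (State r4 m' c).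
    rewrite /= r4d ag4 // r30 r3d1 r3d2 addnC in run5.
    eexists; split; first by apply: runs_Seq run3 _; apply: runs_Seq run4 run5.
      eexists; eexists; split; first by [].
      * apply: agree_trans ag _; apply: (@agree_trans _ _ r3).
        by apply: agree_le ag3.
        by apply: agree_le ag4; lia.
      * rewrite arr_upd // E; apply/funext => k'; apply/funext => j.
        rewrite ltnS [j <= i]leq_eqVlt; case: (k' == k) => //=.
        by case: eqP => [->|].
      * by move=> j jL; rewrite updN ?F //; case: (k) => [|k0]; nia.
    by rewrite /= ag4 //; lia.
  + by exists r1, m1; split=> //; rewrite E1; apply/funext => k'; apply/funext => j;
      rewrite ltn0 andbF.
  subst s2; exists r2, m2, c; split=> //; first exact: runs_Seq run1 run2.
  rewrite /= E2; congr (_, _); apply/funext => k'; apply/funext => j.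
  case: eqP => //= ->; case: ifP => // jL; by rewrite /arr jL.
- have [b1 pb1 H1] := ncompile_correct e.
  exists (fun L => (L * (b1 L + 9 + 5) + 4) + (L * (6 + 5) + 4)); first by poly_bound.
  move=> L d r m c r0 d0.
  pose g i := neval L (arr L m) (narr L c) [:: i] e.
  pose I1 i s := exists r' c', [/\ s = State r' m c', agree d r r',
    narr L c' = narr L c & forall j, j < i -> c' (L + j) = g j].
  have [||||s1 run1 [r1 [c1 [s1E ag1 E1 F1]]]] := @runs_for_loop L d (b1 L + 9)
    (Seq (ncompile [:: d] d.+1 0 e)
            (block (slot d.+1 0 ++ [:: Const d.+2 0; Add d.+2 d.+2 d;
              Add d.+2 d.+2 0; NumConst d.+2 0; NumAdd d.+2 d.+2 d.+1])))
    I1 (State r m c) d0.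
  + by move=> i _ [r' [c' [-> ag _ _]]] /=; rewrite ag.
  + move=> i r' r'' m' c' [? [? [[-> -> ->] ag E F]]] ag'.
    exists r''; eexists; split=> //.
    exact: agree_trans ag (agree_le _ ag').
  + move=> i _ iL [r' [c' [-> ag E F]]] /= r'i.
    have [|||r2 [c2 [run2 ag2 cg2 E2]]] := H1 L [:: d] d.+1 0 r' m c'; rewrite ?ag //=.
      by rewrite ltnSn.
    rewrite addn0 in cg2 E2.
    pose l := [:: Const d.+2 0; Add d.+2 d.+2 d;
              Add d.+2 d.+2 0; NumConst d.+2 0; NumAdd d.+2 d.+2 d.+1].
    have [r3 [E3 ag3 r3d]] := runs_slot 0 r2 m c2 l (ltn0Sn d).
    have run3 := @runs_block (slot d.+1 0 ++ l) (State r2 m c2).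
    rewrite E3 /= in run3; set r4 := upd _ _ _ in run3.
    have r30 : r3 0 = L by rewrite ag3 // ag2 // ag.
    have r3i : r3 d = i by rewrite ag3 // ag2.
    have r4v : r4 d.+2 = L + i.
      by rewrite /r4 !updE !updN ?updE ?updN ?r3i ?r30 //; lia.
    have r4v' : r4 d.+1 = 2 * L.
      by rewrite /r4 !updN ?r3d ?ag2 ?ag ?addn0 //; lia.
    rewrite /= r'i E in E2.
    rewrite r4v r4v' updE add0n updN ?E2 in run3; last by lia.
    eexists; split; first exact: runs_Seq run2 run3; last first.
      by rewrite /= /r4 !updN ?r3i //; lia.
    exists r4; eexists; split; first by [].
    * do 3 (apply: agree_updr; [lia|]).
      apply: agree_trans ag _; apply: (@agree_trans _ _ r2).
        by apply: agree_le ag2.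
        by apply: agree_le ag3.
    * rewrite -E; apply: (@narr_agree L L) => //.
      do 2 (apply: agree_updr; [lia|]); apply: agree_le cg2; lia.
    * move=> j jS; rewrite /upd eqn_add2l; case: eqP => [->//|?].
      by rewrite cg2 ?F //; lia.
  + by exists r, c; split.
  subst s1.
  pose I2 i s := exists r' c', [/\ s = State r' m c', agree d r r',
    narr L c' = fun j => (if j < i then g j else narr L c j)
    & forall j, j < L -> c' (L + j) = g j].
  have [||||s2 run2 [r2 [c2 [s2E ag2 E2 F2]]]] := @runs_for_loop L d 6
    (block [:: Const d.+1 0; Add d.+1 d.+1 d; Add d.+1 d.+1 0;
              NumConst d 0; NumAdd d d d.+1]) I2 (State r1 m c1) d0.
  + by move=> i _ [r' [c' [-> ag _ _]]] /=; rewrite ag.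
  + move=> i r' r'' m' c' [? [? [[-> -> ->] ag E F]]] ag'.
    exists r''; eexists; split=> //.
    exact: agree_trans ag (agree_le _ ag').
  + move=> i _ iL [r' [c' [-> ag E F]]] /= r'i.
    have run3 := @runs_block [:: Const d.+1 0; Add d.+1 d.+1 d; Add d.+1 d.+1 0;
              NumConst d 0; NumAdd d d d.+1] (State r' m c').
    rewrite /= in run3; set r3 := upd _ _ _ in run3.
    have r'0 : r' 0 = L by rewrite ag.
    have r3d : r3 d = i by rewrite /r3 !updN ?r'i //; lia.
    have r3d1 : r3 d.+1 = L + i.
      by rewrite /r3 !updE !updN ?updE ?r'i ?r'0 ?add0n 1?addnC //; lia.
    rewrite r3d r3d1 updE add0n updN ?F // in run3; last by lia.
    eexists; split; [exact: run3| |exact: r3d].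
    exists r3; eexists; split; first by [].
    * by do 3 (apply: agree_updr; [lia|]).
    * apply/funext => j; move/(congr1 (@^~ j)): E; rewrite /narr ltnS.
      case: (ltnP j L) => jL; last first.
        by move=> _; rewrite leqNgt (leq_trans iL jL).
      by rewrite /upd [j <= i]leq_eqVlt; case: eqP => [->|].
    * by move=> j jL; rewrite !updN ?F //; lia.
  + by exists r1, c1; split=> //; rewrite E1.
  subst s2; exists r2, m, c2; split=> //; first exact: runs_Seq run1 run2.
  rewrite /= E2; congr (_, _); apply/funext => j.
  by case: ifP => // jL; rewrite /narr jL.
- exists (fun L => b1 L + b2 L); first by poly_bound.
  move=> L d r m c r0 d0.
  have [r1 [m1 [c1 [run1 ag1 E1]]]] := IH1 L d r m c r0 d0.
  have [|r2 [m2 [c2 [run2 ag2 E2]]]] := IH2 L d r1 m1 c1 _ d0; first by rewrite ag1.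
  exists r2, m2, c2; split; [exact: runs_Seq run1 run2|exact: agree_trans ag2|].
  by rewrite E2 E1.
exists (fun L => L * (b1 L + 5) + 4); first by poly_bound.
move=> L d r m c r0 d0.
pose I i s := exists r' m' c', [/\ s = State r' m' c', agree d r r' &
  (arr L m', narr L c') = iter i (run L p1) (arr L m, narr L c)].
have [||||s1 run1 [r1 [m1 [c1 [s1E ag1 E1]]]]] :=
  @runs_for_loop L d (b1 L) (ccompile d.+1 p1) I (State r m c) d0.
- by move=> i _ [r' [m' [c' [-> ag _]]]] /=; rewrite ag.
- move=> i r' r'' m' c' [? [? [? [[-> -> ->] ag E]]]] ag'.
  exists r''; eexists; eexists; split=> //.
  exact: agree_trans ag (agree_le _ ag').
- move=> i _ iL [r' [m' [c' [-> ag E]]]] /= r'i.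
  have [|//|r1 [m1 [c1 [run1 ag1 E1]]]] := IH1 L d.+1 r' m' c'; first by rewrite ag.
  eexists; split; [exact: run1| |by rewrite /= ag1].
  exists r1, m1, c1; split=> //; last by rewrite E1 E.
  exact: agree_trans ag (agree_le _ ag1).
- by exists r, m, c.
by subst s1; exists r1, m1, c1.
Qed.

(** * Terms, subterms and heights *)

Lemma term_induction (S : signature) (P : term S -> Prop) :
  (forall (f : S) (a : {ffun 'I_(arity f) -> term S}),
    (forall q, P (a q)) -> P (App a)) ->
  forall t, P t.
Proof.
move=> PApp; exact: (fix F t := let: App f a := t in PApp f a (fun q => F (a q))).
Qed.

Definition root_symbol (S : signature) (t : term S) : S := let: App f _ := t in f.

Lemma root_symbolP (S : signature) (t : term S) f : root_symbol t = f ->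
  exists a : {ffun 'I_(arity f) -> term S}, t = App a.
Proof. by case: t => g a /= <-; exists a. Qed.

(** The equality of dependent pairs given by injectivity of the constructor can be projected because
    symbols have decidable equality. *)
Lemma App_inj (S : signature) (f : S) : injective (@App S f).
Proof. by move=> a b [E]; apply: eq_from_Tagged E. Qed.

(** Constants have height 1, so no term has height 0 and the count by height starts from 0. *)
Fixpoint height (S : signature) (t : term S) : nat :=
  let: App f a := t in (\max_(q < arity f) height (a q)).+1.

Lemma height_leS (S : signature) (f : S) (a : {ffun 'I_(arity f) -> term S}) d :
  height (App a) <= d.+1 <-> forall q, height (a q) <= d.
Proof.
rewrite /= ltnS; split=> [/bigmax_leqP H q|H]; first exact: H.
by apply/bigmax_leqP.
Qed.

(** Preorder listing with repetitions, in the order of Polish notation: each word of an encoded term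
    is the root symbol of the subterm listed at the same place. *)
Fixpoint subterms (S : signature) (t : term S) : seq (term S) :=
  let: App f a := t in t :: flatten [seq subterms (a q) | q : 'I_(arity f)].

Lemma subterms_head (S : signature) (t : term S) : exists l, subterms t = t :: l.
Proof. by case: t => f a; eexists. Qed.

Lemma size_subterms (S : signature) (t : term S) : size (subterms t) = term_size t.
Proof.
elim/term_induction: t => f a IH /=; congr _.+1.
by rewrite size_flatten /shape -map_comp; congr sumn; apply: eq_map.
Qed.

Definition code (S : signature) (t : term S) : nat := enum_rank (root_symbol t).

Lemma encode_termE (S : signature) (t : term S) :
  encode_term t = map (@code S) (subterms t).
Proof.
elim/term_induction: t => f a IH /=; congr cons.
by rewrite map_flatten -map_comp; congr flatten; apply: eq_map.
Qed.

(** * Counting terms *)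

Definition card_is (S : signature) (P : term S -> Prop) (n : nat) : Prop :=
  exists l : seq (term S), [/\ uniq l, size l = n & forall s, P s <-> s \in l].

Lemma card_is_iff (S : signature) (P Q : term S -> Prop) n :
  (forall s, P s <-> Q s) -> card_is P n -> card_is Q n.
Proof.
by move=> PQ [l [lu ls lP]]; exists l; split=> // s; rewrite -PQ; apply: lP.
Qed.

(** A choice of one entry from each list is a choice of indices, and the admissible index functions
    form a family of finite functions whose cardinality is the product. *)
Lemma ffun_seq (T : eqType) (x0 : T) n (l : 'I_n -> seq T) : (forall q, uniq (l q)) ->
  exists s : seq {ffun 'I_n -> T}, [/\ uniq s, size s = \prod_(q < n) size (l q)
    & forall g, g \in s <-> forall q, g q \in l q].
Proof.
(* Exceeds the length of every list, so that all indices live in the single finite type ['I_M]. *)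
move=> lu; pose M := (\max_(q < n) size (l q)).+1.
have leM q : size (l q) < M by rewrite ltnS (leq_bigmax q).
pose F (q : 'I_n) := [pred x : 'I_M | x < size (l q)].
exists [seq [ffun q => nth x0 (l q) (g q)] | g : {ffun 'I_n -> 'I_M} in family F].
split.
- rewrite map_inj_in_uniq ?enum_uniq // => g h; rewrite !mem_enum.
  move=> /familyP Fg /familyP Fh /ffunP E; apply/ffunP => q; apply/val_inj/eqP.
  move/(_ q): E; rewrite !ffunE => /eqP; rewrite nth_uniq //.
    exact: (Fg q).
  exact: (Fh q).
- rewrite size_map -cardE card_family foldrE big_map big_enum /=.
  apply: eq_bigr => q _; rewrite -sum1_card.
  rewrite (eq_bigl (fun i : 'I_M => i < size (l q))) //.
  rewrite -(big_mkord (fun i => i < size (l q)) (fun=> 1)).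
  rewrite -(big_nat_widen 0 (size (l q)) M xpredT) ?sum_nat_const_nat; last exact: ltnW.
  by rewrite subn0 muln1.
move=> g; split=> [/mapP[h]|H].
  rewrite mem_enum => /familyP Fh -> q; by rewrite ffunE; apply/mem_nth/(Fh q).
have iM q : index (g q) (l q) < M by apply: leq_ltn_trans (leM q); apply: index_size.
apply/mapP; exists [ffun q => Ordinal (iM q)].
  by rewrite mem_enum; apply/familyP => q; rewrite ffunE inE /= index_mem.
by apply/ffunP => q; rewrite !ffunE /= nth_index.
Qed.

Lemma card_App (S : signature) (t0 : term S) (f : S)
    (P : 'I_(arity f) -> term S -> Prop) (n : 'I_(arity f) -> nat) :
  (forall q, card_is (P q) (n q)) ->
  card_is (fun s => exists2 a : {ffun 'I_(arity f) -> term S},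
                      s = App a & forall q, P q (a q)) (\prod_q n q).
Proof.
move=> /choice[l lP].
have [|s [su ss sP]] := @ffun_seq _ t0 _ l; first by move=> q; case: (lP q).
exists (map (@App S f) s); split.
- by rewrite map_inj_uniq //; apply: App_inj.
- by rewrite size_map ss; apply: eq_bigr => q _; case: (lP q).
move=> t; split=> [[a -> Pa]|/mapP[a /sP as_ ->]].
  by apply: map_f; apply/sP => q; case: (lP q) => _ _ <-.
by exists a => // q; case: (lP q) => _ _ ->.
Qed.

Lemma card_disjoint_sum (S : signature) (r : seq nat) (P : nat -> term S -> Prop)
    (n : nat -> nat) : uniq r ->
  (forall i j s, i \in r -> j \in r -> P i s -> P j s -> i = j) ->
  (forall i, i \in r -> card_is (P i) (n i)) ->
  card_is (fun s => exists2 i, i \in r & P i s) (\sum_(i <- r) n i).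
Proof.
elim: r => [|i r IH] /= => [_ _ _|/andP[ir ru] disj cardP].
  by exists [::]; rewrite big_nil; split=> // s; split=> // -[].
have [||l1 [l1u l1s l1P]] := IH ru.
- by move=> j k s jr kr; apply: disj; rewrite inE ?jr ?kr orbT.
- by move=> j jr; apply: cardP; rewrite inE jr orbT.
have [|l2 [l2u l2s l2P]] := cardP i; first by rewrite mem_head.
exists (l2 ++ l1); split.
- rewrite cat_uniq l2u l1u andbT /=; apply/hasPn => s /l1P[j jr Pj]; apply/negP.
  move=> /l2P Pi; move: ir; rewrite (disj i j s) ?jr // ?mem_head //.
  by rewrite inE jr orbT.
- by rewrite size_cat l1s l2s big_cons.
move=> s; rewrite mem_cat; split=> [[j]|/orP[/l2P Pi|/l1P[j jr Pj]]].
- rewrite inE => /orP[/eqP-> /l2P->//|jr Pj].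
  by apply/orP; right; apply/l1P; exists j.
- by exists i; rewrite ?mem_head.
- by exists j; rewrite // inE jr orbT.
Qed.

(** * Congruence classes as labels *)

(** A finite presentation of the congruence on the terms occurring in the
    input: [node i] is the term at position [i], [ch i q] the position of its
    argument number [q], and [R i] the label of its class, itself a position. *)
Section Labels.
Variables (S : signature) (G : seq (term S * term S)) (L : nat).
Variables (node : nat -> term S) (ch : nat -> nat -> nat).

Let V (i : nat) : bool := 0 < i < L.

Definition congruent (R : nat -> nat) (i j : nat) : Prop :=
  root_symbol (node i) = root_symbol (node j) /\
  forall q, q < arity (root_symbol (node i)) -> R (ch i q) = R (ch j q).

Hypothesis chP : forall i (f : S) (a : {ffun 'I_(arity f) -> term S}),
  V i -> node i = App a -> forall q : 'I_(arity f), V (ch i q) /\ node (ch i q) = a q.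

(** Here [R] is any sound labelling: the lemma is applied to the intermediate labellings of the
    propagation too. *)
Lemma congruent_derivable (R : nat -> nat) i j :
  (forall i, V i -> V (R i) /\ derivable G (node i) (node (R i))) ->
  V i -> V j -> congruent R i j -> derivable G (node i) (node j).
Proof.
move=> RP Vi Vj [sij Rij].
have [b Ej] := root_symbolP (esym sij).
have [a Ei] := root_symbolP (erefl (root_symbol (node i))).
rewrite {1}Ei Ej; apply: derivable_cong => q.
have [Vci <-] := chP Vi Ei q; have [Vcj <-] := chP Vj Ej q.
apply: derivable_trans (proj2 (RP _ Vci)) _.
rewrite Rij //; apply: derivable_sym; exact: (proj2 (RP _ Vcj)).
Qed.

(** * The tree automaton of a stable labelling *)

Variable R : nat -> nat.
Hypothesis RP : forall i, V i -> V (R i) /\ derivable G (node i) (node (R i)).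
Hypothesis R_congruent : forall i j, V i -> V j -> congruent R i j -> R i = R j.
Hypothesis R_equation : forall p q, (p, q) \in G ->
  exists i j, [/\ V i, V j, node i = p, node j = q & R i = R j].

(** Runs of the bottom-up tree automaton: position [j] is the transition from the labels of its
    arguments, under its root symbol, to the state [R j]. *)
Fixpoint evaluates (s : term S) (c : nat) : Prop :=
  let: App f a := s in exists j, [/\ V j, c = R j, root_symbol (node j) = f
    & forall q, evaluates (a q) (R (ch j q))].

(** The automaton is deterministic: transitions with the same symbol and the same argument states
    come from congruent positions, whose labels coincide. *)
Lemma evaluates_inj s c c' : evaluates s c -> evaluates s c' -> c = c'.
Proof.
elim/term_induction: s c c' => f a IH c c' /= [j [Vj -> sj Ej]] [j' [Vj' -> sj' Ej']].
apply: R_congruent => //; split; first by rewrite sj sj'.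
by move=> q; rewrite sj => qf; apply: (IH (Ordinal qf)); [apply: Ej|apply: Ej'].
Qed.

Lemma evaluates_node i : V i -> evaluates (node i) (R i).
Proof.
suff H s : forall i, node i = s -> V i -> evaluates s (R i) by exact: H.
elim/term_induction: s {i} => f a IH i E Vi.
exists i; split=> //; first by rewrite E.
by move=> q; have [Vc Ec] := chP Vi E q; apply: IH.
Qed.

(** Replacing the arguments of [s] by those of the position [j] used at the root turns [s] into
    [node j], which has the same label as [node i]. *)
Lemma evaluates_derivable s i : V i -> evaluates s (R i) -> derivable G s (node i).
Proof.
elim/term_induction: s i => f a IH i Vi /= [j [Vj Rij sj Ej]].
have [b E] := root_symbolP sj.
apply: (@derivable_trans _ _ _ (node j)); last first.
  apply: derivable_trans (proj2 (RP Vj)) _; rewrite -Rij.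
  by apply: derivable_sym; case: (RP Vi).
rewrite E; apply: derivable_cong => q; have [Vc <-] := chP Vj E q.
by apply: IH => //; apply: Ej.
Qed.

(** Reaching the same states is a congruence. It contains the equations, since both sides are nodes
    with equal labels and a term reaches at most one state. *)
Lemma derivable_evaluates s s' : derivable G s s' ->
  forall c, evaluates s c <-> evaluates s' c.
Proof.
elim=> {s s'} [p q pq c|//|p q _ IH c|p q r _ IH1 _ IH2 c|f a b _ IH c].
- have [i [j [Vi Vj <- <- Rij]]] := R_equation pq.
  have Ei := evaluates_node Vi; have Ej := evaluates_node Vj.
  split=> [/(evaluates_inj Ei)<-|/(evaluates_inj Ej)<-]; first by rewrite Rij.
  by rewrite -Rij.
- by rewrite IH.
- by rewrite IH1 IH2.
- by split=> -[j [Vj cE sj Ej]]; exists j; split=> // q;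
    [exact: (proj1 (IH q _) (Ej q))|exact: (proj2 (IH q _) (Ej q))].
Qed.

Lemma congruence_class_evaluates i s : V i ->
  congruence_class G (node i) s <-> evaluates s (R i).
Proof.
move=> Vi; split=> [D|]; last exact: evaluates_derivable.
by apply/(derivable_evaluates D); apply: evaluates_node.
Qed.

(** Congruent positions give the same transition; keeping only the least one avoids counting a term
    twice. *)
Definition canonical (j : nat) : Prop :=
  V j /\ forall j', 0 < j' < j -> ~ congruent R j' j.

(** Terms in the class of [i] correspond to the choice of a class of congruent
    positions, represented by its least element, and of the arguments. *)
Lemma card_evaluates_step (t0 : term S) (d i : nat) (N : nat -> nat) : V i ->
  (forall j, V j -> card_is (fun s => evaluates s (R j) /\ height s <= d) (N j)) ->
  card_is (fun s => evaluates s (R i) /\ height s <= d.+1)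
    (\sum_(j < L) if `[< canonical j >] && (R j == R i)
       then \prod_(q < arity (root_symbol (node j))) N (ch j q) else 0).
Proof.
move=> Vi cardN.
pose P j s := exists2 a : {ffun 'I_(arity (root_symbol (node j))) -> term S},
  s = App a & forall q, evaluates (a q) (R (ch j q)) /\ height (a q) <= d.
pose r := [seq j <- iota 0 L | `[< canonical j >] && (R j == R i)].
have rP j : j \in r <-> [/\ canonical j & R j = R i].
  rewrite mem_filter mem_iota /= add0n.
  split=> [/andP[/andP[/asboolP cj /eqP E] _]|[cj E]].
    by [].
  rewrite E eqxx andbT; apply/andP; split; first exact/asboolP.
  by case: cj => /andP[].
rewrite -(big_mkord xpredT (fun j => if `[< canonical j >] && (R j == R i)
       then \prod_(q < arity (root_symbol (node j))) N (ch j q) else 0)).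
rewrite -big_mkcond /index_iota subn0 -big_filter -/r.
have H j s : P j s -> canonical j -> R j = R i ->
    evaluates s (R i) /\ height s <= d.+1.
  move=> [a -> Ea] [Vj _] Rj; split; last by apply/height_leS => q; case: (Ea q).
  by exists j; split=> // q; case: (Ea q).
apply: card_is_iff (card_disjoint_sum _ (P := P) _ _).
- move=> s; split=> [[j /rP[cj Rj] /H]|]; first exact.
  case: s => f a [[j0 [Vj0 Rj0 sj0 Ej0]] /height_leS ha].
  (* Positions whose transition applies at the root of [App a]. The least one is canonical, as a
     smaller congruent position would also belong to [W]. *)
  pose W j := `[< [/\ V j, root_symbol (node j) = f
    & forall q, evaluates (a q) (R (ch j q))] >].
  have exW : exists j, W j by exists j0; apply/asboolP.
  case: (ex_minnP exW) => j /asboolP[Vj sj Ej] minj.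
  have congW j' : V j' -> congruent R j' j -> W j'.
    move=> Vj' [ss Rc]; apply/asboolP; split=> //; first by rewrite ss.
    by move=> q; rewrite Rc // ss sj.
  exists j; last first.
    rewrite /P; move: sj; move: (root_symbol (node j)) => g gf; subst g.
    by exists a.
  apply/rP; split.
    split=> // j' /andP[j'0 j'j] C.
    have Vj' : V j' by move: Vj => /andP[_ jL]; rewrite /V j'0 (ltn_trans j'j).
    by have := minj _ (congW _ Vj' C); rewrite leqNgt j'j.
  rewrite Rj0; apply: R_congruent => //; split; first by rewrite sj.
  move=> q; rewrite sj => qf.
  exact: (evaluates_inj (Ej (Ordinal qf)) (Ej0 (Ordinal qf))).
- exact: filter_uniq (iota_uniq _ _).
(* A term counted at both positions would make them congruent, and then the larger one is not
   canonical. *)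
- have wlog_lt j j' s : j < j' -> canonical j -> canonical j' -> P j s -> P j' s -> False.
    move=> jj' [Vj _] [_ cj'] [a sa Ea] [b sb Eb].
    have j0 : 0 < j < j' by case/andP: Vj => ->.
    apply: (cj' j j0); have := congr1 (@root_symbol S) sa; rewrite sb /= => ss.
    split=> // q qf; move: ss a sa Ea; rewrite /congruent.
    move: qf; move: (root_symbol (node j)) => f qf ff; subst f => a sa Ea.
    have ab : a = b by move: sa; rewrite sb => /App_inj.
    subst b; apply: (evaluates_inj (proj1 (Ea (Ordinal qf))) (proj1 (Eb (Ordinal qf)))).
  move=> j j' s /rP[cj _] /rP[cj' _] Pj Pj'.
  case: (ltngtP j j') => // lt; exfalso; first exact: (wlog_lt j j' s).
  exact: (wlog_lt j' j s).
move=> j /rP[cj Rj]; apply: (@card_App S t0 _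
  (fun q s => evaluates s (R (ch j q)) /\ height s <= d) (fun q => N (ch j q))) => q.
apply: cardN.
have [a Ea] := root_symbolP (erefl (root_symbol (node j))).
by have [] := chP (proj1 cj) Ea q.
Qed.

Lemma card_evaluates0 i : card_is (fun s => evaluates s (R i) /\ height s <= 0) 0.
Proof. by exists [::]; split=> // -[f a]; split=> // -[_]. Qed.

(** A high term has a high argument. Conversely, a high term replaces argument [q] of [node j],
    whose other arguments are kept. *)
Lemma high_evaluates_step d i : V i ->
  (exists2 s, evaluates s (R i) & d.+1 < height s) <->
  (exists j q, [/\ V j, R j = R i, q < arity (root_symbol (node j))
    & exists2 s, evaluates s (R (ch j q)) & d < height s]).
Proof.
move=> Vi; split=> [[[f a] [j [Vj Rj sj Ej]]]|[j [q [Vj Rj qj [s Es hs]]]]].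
  rewrite ltnNge => /negP h.
  have [q /negP] : exists q, ~ height (a q) <= d.
    by apply/existsNP => H; apply: h; apply/height_leS.
  rewrite -ltnNge => hq.
  exists j, q; split=> //; first by rewrite sj.
  by exists (a q) => //; apply: Ej.
have [b Eb] := root_symbolP (erefl (root_symbol (node j))).
pose q0 := Ordinal qj.
exists (App [ffun q' => if q' == q0 then s else b q']).
  exists j; split=> // q'; rewrite ffunE; case: eqP => [->//|_].
  by have [Vc <-] := chP Vj Eb q'; apply: evaluates_node.
rewrite ltnNge; apply/negP => /height_leS /(_ q0).
by rewrite ffunE eqxx leqNgt hs.
Qed.

End Labels.

(** * Finiteness, heights and stabilization of decreasing iterations *)

Lemma has_size_card (S : signature) (A : set (term S)) n : card_is A n ->
  has_size A (Some n).
Proof.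
move=> [l [lu <- lP]] /=.
apply/card_set_bijP; exists (index^~ l); split=> [s /lP|s u|k /= kl].
- by rewrite /= -index_mem.
- by rewrite !inE => /lP sl /lP ul /(congr1 (nth s l)); rewrite !nth_index.
case: l => // s l in lu lP kl *; exists (nth s (s :: l) k); last exact: index_uniq.
by apply/lP/mem_nth.
Qed.

(** The heights of finitely many terms have a maximum. *)
Lemma infinite_height (S : signature) (A : set (term S)) :
  (forall d, exists2 s, A s & d < height s) -> has_size A None.
Proof.
move=> H /finite_seqP[l lA].
have [s As hs] := H (\max_(u <- l) height u).
move: As; rewrite lA /= => sl; move: hs; rewrite ltnNge => /negP; apply.
exact: leq_bigmax_seq.
Qed.

(** Every round that changes something lowers the sum of the entries by at least 1, and a stable
    array stays stable. *)
Lemma iter_fixpoint (L K : nat) (F : (nat -> nat) -> nat -> nat) (X : nat -> nat) :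
  (forall Y i, F Y i <= Y i) -> (forall i, L <= i -> X i = 0) ->
  \sum_(i < L) X i <= K -> F (iter K F X) = iter K F X.
Proof.
move=> FY X0 sX.
have z k i : L <= i -> iter k F X i = 0.
  move=> Li; elim: k => [|k IH] /=; first exact: X0.
  by apply/eqP; rewrite -leqn0 -IH.
have [//|] : F (iter K F X) = iter K F X \/
    \sum_(i < L) iter K F X i + K <= \sum_(i < L) X i.
  elim: {sX} K => [|k IH]; first by right; rewrite addn0.
  have [E|ne] := pselect (F (iter k F X) = iter k F X).
    by left; rewrite iterS E.
  have {}IH : \sum_(i < L) iter k F X i + k <= \sum_(i < L) X i by case: IH.
  right; rewrite addnS; apply: leq_trans IH; rewrite ltn_add2r.
  have [i ni] : exists i, F (iter k F X) i <> iter k F X i.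
    by apply/not_existsP => H; apply: ne; apply/funext => i; apply: contrapT.
  have iL : i < L by rewrite ltnNge; apply/negP => Li; rewrite -iterS !z in ni.
  rewrite (bigD1 (Ordinal iL)) // [X in _ < X](bigD1 (Ordinal iL)) //= -addSn.
  apply: leq_add; last by apply: leq_sum.
  by rewrite ltn_neqAle FY andbT; apply/eqP.
(* If all [K] rounds changed something, the sum has dropped to 0, and the zero array cannot decrease
   further. *)
move=> le; have /eqP : \sum_(i < L) iter K F X i = 0 by lia.
rewrite sum_nat_eq0 => /forallP H; apply/funext => i; apply/eqP; rewrite eqn_leq FY.
have [iL|/z->//] := ltnP i L.
by have /eqP -> := H (Ordinal iL).
Qed.

(** * Parsing Polish notation *)

Definition input_terms (S : signature) (x : seq (term S * term S) * term S) :
    seq (term S) :=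
  flatten [seq [:: e.1; e.2] | e <- x.1] ++ [:: x.2].

(** Position 0, which holds the number of equations, gets a dummy term. *)
Definition positions (S : signature) (x : seq (term S * term S) * term S) :
    seq (term S) :=
  x.2 :: flatten (map (@subterms S) (input_terms x)).

Definition node (S : signature) (x : seq (term S * term S) * term S) (i : nat) :
    term S :=
  nth x.2 (positions x) i.

Lemma encode_inputE (S : signature) (x : seq (term S * term S) * term S) :
  encode_input x = size x.1 :: map (@code S) (behead (positions x)).
Proof.
case: x => G t; rewrite /encode_input /positions /input_terms /=; congr cons.
rewrite map_cat flatten_cat map_cat /= cats0 -encode_termE; congr (_ ++ _).
elim: G => //= e G ->.
by rewrite !map_cat -!encode_termE catA.
Qed.

Lemma size_encode_input (S : signature) (x : seq (term S * term S) * term S) :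
  size (encode_input x) = size (positions x).
Proof. by rewrite encode_inputE /= size_map. Qed.

Lemma size_encode_measure (S : signature) (x : seq (term S * term S) * term S) :
  size (encode_input x) = (equations_size x.1 + term_size x.2).+1.
Proof.
have sz (u : term S) : size (encode_term u) = term_size u.
  by rewrite encode_termE size_map size_subterms.
case: x => G t; rewrite /encode_input /= size_cat sz; congr (_ + _).+1.
rewrite /equations_size; elim: G => [|e G IH]; first by rewrite big_nil.
by rewrite big_cons /= size_cat IH size_cat !sz.
Qed.

Lemma encode_input_code (S : signature) (x : seq (term S * term S) * term S) i :
  0 < i < size (positions x) -> nth 0 (encode_input x) i = code (node x i).
Proof.
rewrite encode_inputE; case: i => // i /=; rewrite ltnS => lt.
by rewrite (nth_map x.2).
Qed.

(** The prefix property of Polish notation, which allows arguments to be found by skipping whole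
    subterms. *)
Definition subterm_closed (S : signature) (t0 : term S) (l : seq (term S)) : Prop :=
  forall i, i < size l -> exists l', drop i l = subterms (nth t0 l i) ++ l'.

Lemma subterm_closed_cat (S : signature) (t0 : term S) l1 l2 :
  subterm_closed t0 l1 -> subterm_closed t0 l2 -> subterm_closed t0 (l1 ++ l2).
Proof.
move=> H1 H2 i; rewrite size_cat drop_cat nth_cat.
case: (ltnP i (size l1)) => [lt _|ge lt].
  by have [l' ->] := H1 i lt; exists (l' ++ l2); rewrite catA.
by apply: H2; lia.
Qed.

Lemma subterm_closed_flatten (S : signature) (t0 : term S) (I : Type) (r : seq I)
    (F : I -> seq (term S)) : (forall j, subterm_closed t0 (F j)) ->
  subterm_closed t0 (flatten (map F r)).
Proof. by move=> H; elim: r => [|j r IH] //=; apply: subterm_closed_cat. Qed.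

Lemma subterm_closed_subterms (S : signature) (t0 t : term S) :
  subterm_closed t0 (subterms t).
Proof.
elim/term_induction: t => f a IH [|i] /= lt; first by exists [::]; rewrite cats0.
by apply: subterm_closed_flatten lt.
Qed.

Lemma drop_positions (S : signature) (x : seq (term S * term S) * term S) i :
  0 < i < size (positions x) ->
  exists l, drop i (positions x) = subterms (node x i) ++ l.
Proof.
case: i => // i /=; rewrite ltnS => lt.
exact: (@subterm_closed_flatten S x.2 _ (input_terms x) _
          (@subterm_closed_subterms S x.2) i lt).
Qed.

(** If [E] jumps over one subterm, its iterates visit consecutively listed terms. Correctness of [E]
    is assumed only at the terms of [us], so that the lemma applies to arguments while [E] is still
    under construction. *)
Lemma walk (S : signature) (x : seq (term S * term S) * term S) (E : nat -> nat)
    (us l : seq (term S)) j : 0 < j ->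
  (forall i, 0 < i < size (positions x) -> node x i \in us ->
     E i = i + size (subterms (node x i))) ->
  drop j (positions x) = flatten (map (@subterms S) us) ++ l ->
  iter (size us) E j = j + size (flatten (map (@subterms S) us)) /\
  forall q, q < size us -> 0 < iter q E j < size (positions x) /\
    node x (iter q E j) = nth x.2 us q.
Proof.
move=> j0; elim: us j j0 => [|u us IH] j j0 HE /= Hd; first by rewrite addn0.
have [l1 El1] := subterms_head u.
have jL : j < size (positions x).
  by rewrite ltnNge; apply/negP => /drop_oversize; rewrite Hd El1.
have nj : node x j = u by rewrite /node -[j]addn0 -nth_drop Hd El1.
have Ej : E j = j + size (subterms u) by rewrite HE ?j0 ?nj ?mem_head.
have [|||IH1 IH2] := IH (E j).
- by rewrite Ej; lia.
- by move=> i iV iu; apply: HE => //; rewrite inE iu orbT.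
- by rewrite Ej addnC -drop_drop Hd -catA drop_size_cat.
split; first by rewrite -iterS iterSr IH1 Ej size_cat addnA.
case=> [_|q qs]; first by rewrite /= j0 jL nj.
by rewrite iterSr; apply: IH2.
Qed.

Lemma walk_args (S : signature) (x : seq (term S * term S) * term S) (E : nat -> nat)
    (f : S) (a : {ffun 'I_(arity f) -> term S}) i :
  0 < i < size (positions x) -> node x i = App a ->
  (forall i, 0 < i < size (positions x) -> node x i \in codom a ->
     E i = i + size (subterms (node x i))) ->
  iter (arity f) E i.+1 = i + size (subterms (App a)) /\
  forall q : 'I_(arity f), 0 < iter q E i.+1 < size (positions x) /\
    node x (iter q E i.+1) = a q.
Proof.
move=> Vi Ei HE.
have [l] := drop_positions Vi; rewrite Ei => Hd.
have sz : size (codom a) = arity f by rewrite size_codom card_ord.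
have fl : [seq subterms (a q) | q : 'I_(arity f)] = map (@subterms S) (codom a).
  by rewrite /codom /image_mem -map_comp.
have Hd' : drop i.+1 (positions x) = flatten (map (@subterms S) (codom a)) ++ l.
  by rewrite -add1n -drop_drop Hd /= drop0 fl.
have [H1 H2] := walk (ltn0Sn i) HE Hd'.
split; first by rewrite -{1}sz H1 /= fl addSnnS.
move=> q; have [|H3 ->] := H2 q; first by rewrite sz.
split=> //; rewrite (nth_map q) ?nth_ord_enum //.
by rewrite size_enum_ord.
Qed.

(** After [r] rounds the ends of all subterms with at most [r] nodes are right, because arguments
    are smaller; no subterm has more nodes than there are positions. *)
Lemma ends_correct (S : signature) (x : seq (term S * term S) * term S)
    (E : nat -> nat -> nat) :
  (forall r i, 0 < i < size (positions x) ->
     E r.+1 i = iter (arity (root_symbol (node x i))) (E r) i.+1) ->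
  forall i, 0 < i < size (positions x) ->
    E (size (positions x)) i = i + size (subterms (node x i)).
Proof.
move=> HE.
suff H r i : 0 < i < size (positions x) -> size (subterms (node x i)) <= r ->
    E r i = i + size (subterms (node x i)).
  move=> i Vi; apply: H => //; have [l /(congr1 size)] := drop_positions Vi.
  by rewrite size_drop size_cat; lia.
elim: r i => [|r IH] i Vi.
  by have [l ->] := subterms_head (node x i).
case Ei : (node x i) => [f a] ss; rewrite HE // Ei /=.
have [j Vj /codomP[q Ej]|-> _ //] := walk_args (E := E r) Vi Ei.
apply: IH => //; rewrite Ej.
suff : size (subterms (a q)) < size (subterms (App a)) by lia.
rewrite !size_subterms /= ltnS sumnE big_map big_enum /= (bigD1 q) //=.
exact: leq_addr.
Qed.

Lemma nth_input_terms (S : signature) (x : seq (term S * term S) * term S) k :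
  k < size x.1 ->
  (nth x.2 (input_terms x) k.*2, nth x.2 (input_terms x) k.*2.+1) =
  nth (x.2, x.2) x.1 k.
Proof.
case: x => G t /=; rewrite /input_terms /=.
by elim: G k => [|[p q] G IH] [|k] //=; apply: IH.
Qed.

Lemma size_input_terms (S : signature) (x : seq (term S * term S) * term S) :
  size (input_terms x) = (size x.1).*2.+1.
Proof.
case: x => G t; rewrite /input_terms /= size_cat addn1; congr _.+1.
by elim: G => //= e G ->.
Qed.

Lemma last_input_terms (S : signature) (x : seq (term S * term S) * term S) :
  nth x.2 (input_terms x) (size x.1).*2 = x.2.
Proof.
rewrite nth_cat ltnNge; have := size_input_terms x.
rewrite /input_terms size_cat addn1 => -[->].
by rewrite leqnn subnn.
Qed.

(** Each input term fills at least one position, hence an array of [L] entries can list them all. *)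
Lemma size_input_terms_positions (S : signature) (x : seq (term S * term S) * term S) :
  size (input_terms x) < size (positions x).
Proof.
rewrite /positions /= ltnS; elim: (input_terms x) => //= u us IH.
by rewrite size_cat; have [l ->] := subterms_head u; rewrite /=; lia.
Qed.

Lemma walk_roots (S : signature) (x : seq (term S * term S) * term S) (E : nat -> nat) :
  (forall i, 0 < i < size (positions x) -> E i = i + size (subterms (node x i))) ->
  forall k, k < size (input_terms x) -> 0 < iter k E 1 < size (positions x) /\
    node x (iter k E 1) = nth x.2 (input_terms x) k.
Proof.
move=> HE; apply: (proj2 (@walk S x E (input_terms x) [::] 1 isT _ _)).
  by move=> i Vi _; apply: HE.
by rewrite /positions /= drop0 cats0.
Qed.

(** * The algorithm *)

Definition Not (e : expr) : expr := Ite e (Lit 0) (Lit 1).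
Definition And (e1 e2 : expr) : expr := Ite e1 e2 (Lit 0).
Definition Or (e1 e2 : expr) : expr := Ite e1 (Lit 1) e2.
Definition Lt (e1 e2 : expr) : expr := Minus e2 e1.
Definition Eq (e1 e2 : expr) : expr := Not (Plus (Minus e1 e2) (Minus e2 e1)).

(** In [e], the bound index is [Var 0], and the free variables are shifted by 2. *)
Definition Exists (e : expr) : expr := Fold (Lit 0) (Ite e (Lit 1) (Var 1)).

(** Array 0 is the input, array 1 maps each position to the end of its subterm,
    array 2 lists the positions of the input terms, array 3 maps each position
    to the label of its class, and array 4 tells, after [d] rounds, whether a
    class has an element of height greater than [d]. *)
Definition Sym (e : expr) : expr := Arr 0 e.
Definition End (e : expr) : expr := Arr 1 e.
Definition Root (e : expr) : expr := Arr 2 e.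
Definition Label (e : expr) : expr := Arr 3 e.
Definition High (e : expr) : expr := Arr 4 e.

(** The first argument starts right after the root symbol, and each [End] skips one argument. *)
Definition Child (q : nat) (e : expr) : expr := iter q End (Plus e (Lit 1)).

(** The signature is fixed, so a case distinction on symbols is a finite expression and loops over
    arguments can be unrolled in each branch. *)
Definition Case (S : signature) (e : expr) (F : S -> expr) : expr :=
  foldr (fun (f : S) e' => Ite (Eq (Sym e) (Lit (enum_rank f))) (F f) e')
    (Lit 0) (enum S).

Definition NCase (S : signature) (e : expr) (F : S -> nexpr) : nexpr :=
  foldr (fun (f : S) e' => NIte (Eq (Sym e) (Lit (enum_rank f))) (F f) e')
    (NLit 0) (enum S).

(** The first two tests exclude position 0, whose word is the number of equations and not a
    symbol. *)
Definition Congruent (S : signature) (e1 e2 : expr) : expr :=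
  And e1 (And e2 (And (Eq (Sym e1) (Sym e2))
    (@Case S e1 (fun f => foldr (fun q e => And
        (Eq (Label (Child q e1)) (Label (Child q e2))) e)
      (Lit 1) (iota 0 (arity f)))))).

(** Word 0 bounds the equation number [k]; the sides of equation [k] are the input terms [2 * k] and
    [2 * k + 1]. *)
Definition Equation (m n : nat) : expr :=
  Exists (And (Lt (Var 0) (Sym (Lit 0)))
    (And (Eq (Root (Plus (Var 0) (Var 0))) (Var m.+2))
         (Eq (Root (Plus (Plus (Var 0) (Var 0)) (Lit 1))) (Var n.+2)))).

Definition Canonical_position (S : signature) (n : nat) : expr :=
  And (Var n)
    (Not (Exists (And (Lt (Var 0) (Var n.+2)) (Congruent S (Var 0) (Var n.+2))))).

Definition end_step (S : signature) : expr :=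
  @Case S (Var 0) (fun f => Child (arity f) (Var 0)).

Definition root_step : expr := Ite (Var 0) (End (Root (Minus (Var 0) (Lit 1)))) (Lit 1).

(** Inside the fold, [Var 0] is the other position, [Var 1] the least label found so far, and
    [Var 2] the position being relabelled. *)
Definition label_step (S : signature) : expr :=
  Fold (Label (Var 0))
    (Ite (And (Lt (Label (Var 0)) (Var 1))
           (Or (Congruent S (Var 0) (Var 2)) (Or (Equation 0 2) (Equation 2 0))))
      (Label (Var 0)) (Var 1)).

(** The conjunct [High (Var 0)] makes the flags decrease from round to round; it is harmless, as an
    element higher than [d.+1] is higher than [d]. *)
Definition high_step (S : signature) : expr :=
  And (High (Var 0))
    (Exists (And (Var 0) (And (Eq (Label (Var 0)) (Label (Var 2)))
      (@Case S (Var 0) (fun f => foldr (fun q e => Or (High (Child q (Var 0))) e)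
        (Lit 0) (iota 0 (arity f))))))).

Definition count_step (S : signature) : nexpr :=
  NSum (NIte (And (Canonical_position S 0) (Eq (Label (Var 0)) (Label (Var 1))))
    (@NCase S (Var 0) (fun f => foldr (fun q e => NMul (NArr (Child q (Var 0))) e)
       (NLit 1) (iota 0 (arity f))))
    (NLit 0)).

(** The term whose class is counted comes after the two sides of every equation. *)
Definition target : expr := Root (Plus (Sym (Lit 0)) (Sym (Lit 0))).

(** The nested [Repeat] yields the [L * L] rounds of propagation. The last command writes the count
    for [target] in every entry, in particular in cell 0, where the output is read. *)
Definition algorithm (S : signature) : cmd :=
  CSeq (Repeat (Tab 1 (end_step S)))
  (CSeq (Repeat (Tab 2 root_step))
  (CSeq (Tab 3 (Var 0))
  (CSeq (Repeat (Repeat (Tab 3 (label_step S))))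
  (CSeq (Tab 4 (Lit 1))
  (CSeq (Repeat (Tab 4 (high_step S)))
  (CSeq (Repeat (NTab (count_step S)))
    (NTab (NArr target)))))))).

(** * Values of the expressions of the algorithm *)

Lemma eval_Eq L A rho e1 e2 :
  eval L A rho (Eq e1 e2) = (eval L A rho e1 == eval L A rho e2).
Proof.
rewrite /=; have [->|ne] := eqVneq (eval L A rho e1) (eval L A rho e2).
  by rewrite subnn.
by case: ifP => // /negbFE; lia.
Qed.

Lemma eval_And L A rho e1 e2 : (eval L A rho (And e1 e2) != 0) =
  (eval L A rho e1 != 0) && (eval L A rho e2 != 0).
Proof. by rewrite /=; case: ifP. Qed.

Lemma eval_Or L A rho e1 e2 : (eval L A rho (Or e1 e2) != 0) =
  (eval L A rho e1 != 0) || (eval L A rho e2 != 0).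
Proof. by rewrite /=; case: ifP. Qed.

Lemma eval_Not L A rho e : (eval L A rho (Not e) != 0) = (eval L A rho e == 0).
Proof. by rewrite /=; case: (eval L A rho e). Qed.

Lemma eval_Lt L A rho e1 e2 :
  (eval L A rho (Lt e1 e2) != 0) = (eval L A rho e1 < eval L A rho e2).
Proof. by rewrite /= subn_eq0 ltnNge. Qed.

Lemma eval_Exists L A rho e (P : pred nat) :
  (forall i acc, i < L -> (eval L A [:: i, acc & rho] e != 0) = P i) ->
  eval L A rho (Exists e) = has P (iota 0 L).
Proof.
move=> HP; rewrite /=.
suff H n : n <= L -> iteri n (fun i acc => if eval L A [:: i, acc & rho] e != 0
    then 1 else acc) 0 = has P (iota 0 n) by exact: H.
elim: n => [|n IH] nL //; rewrite iteriSr.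
rewrite HP // IH; last exact: ltnW.
rewrite -[in RHS]addn1 iotaD has_cat /= orbF; case: (P n); first by rewrite orbT.
by rewrite orbF.
Qed.

Lemma eval_Child L A rho q e :
  eval L A rho (Child q e) = iter q (A 1) (eval L A rho e).+1.
Proof. by rewrite /Child; elim: q => [|q IH] /=; rewrite ?addn1 // IH. Qed.

Lemma eval_Case (S : signature) L A rho e (F : S -> expr) f :
  A 0 (eval L A rho e) = enum_rank f -> eval L A rho (Case e F) = eval L A rho (F f).
Proof.
move=> Ef; rewrite /Case; have : f \in enum S by rewrite mem_enum.
elim: (enum S) => //= g s IH; rewrite inE -/(Eq _ _).
have -> : (eval L A rho (Eq (Sym e) (Lit (enum_rank g))) != 0) = (f == g).
  by rewrite eval_Eq /= Ef (inj_eq val_inj) (inj_eq enum_rank_inj); case: (f == g).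
by have [-> //|_] := eqVneq f g.
Qed.

Lemma neval_NCase (S : signature) L A N rho e (F : S -> nexpr) f :
  A 0 (eval L A rho e) = enum_rank f ->
  neval L A N rho (NCase e F) = neval L A N rho (F f).
Proof.
move=> Ef; rewrite /NCase; have : f \in enum S by rewrite mem_enum.
elim: (enum S) => //= g s IH; rewrite inE -/(Eq _ _).
have -> : (eval L A rho (Eq (Sym e) (Lit (enum_rank g))) != 0) = (f == g).
  by rewrite eval_Eq /= Ef (inj_eq val_inj) (inj_eq enum_rank_inj); case: (f == g).
by have [-> //|_] := eqVneq f g.
Qed.

Lemma eval_all L A rho (F : nat -> expr) s :
  (eval L A rho (foldr (fun q e => And (F q) e) (Lit 1) s) != 0) =
  all (fun q => eval L A rho (F q) != 0) s.
Proof. by elim: s => //= q s <-; case: ifP. Qed.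

Lemma eval_has L A rho (F : nat -> expr) s :
  (eval L A rho (foldr (fun q e => Or (F q) e) (Lit 0) s) != 0) =
  has (fun q => eval L A rho (F q) != 0) s.
Proof. by elim: s => //= q s <-; case: ifP. Qed.

Lemma neval_prod L A N rho (F : nat -> nexpr) s :
  neval L A N rho (foldr (fun q e => NMul (F q) e) (NLit 1) s) =
  \prod_(q <- s) neval L A N rho (F q).
Proof. by elim: s => [|q s IH]; rewrite ?big_nil // big_cons -IH. Qed.

Lemma iteri_min L (X : nat -> nat) (P : pred nat) (x0 : nat) :
  let m := iteri L (fun j acc => if (X j < acc) && P j then X j else acc) x0 in
  [/\ m <= x0, forall j, j < L -> P j -> m <= X j
    & m = x0 \/ exists j, [/\ j < L, P j & m = X j]].
Proof.
elim: L => [|L /= [le0 leX IH]]; first by split=> //; left.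
set m := iteri L _ x0 in le0 leX IH *.
case: ifP => [/andP[lt PL]|ge].
  split; first by lia.
  - move=> j; rewrite ltnS leq_eqVlt => /orP[/eqP->//|jL Pj].
    by have := leX j jL Pj; lia.
  - by right; exists L.
split=> //.
- move=> j; rewrite ltnS leq_eqVlt => /orP[/eqP->|]; last exact: leX.
  by move: ge; case: ltnP => //= _ /negbT/negP.
- by case: IH => [|[j [jL Pj E]]]; [left|right; exists j; split=> //; lia].
Qed.

(** * Repeated assignments as iterations on a single array *)

Definition set_array (A : nat -> nat -> nat) (k : nat) (X : nat -> nat) :=
  fun k' i => if k' == k then X i else A k' i.

(** With the other arrays frozen, an assignment to array [k] is a map on single arrays, to which
    [iter_fixpoint] applies. *)
Definition tab_step (L : nat) (A : nat -> nat -> nat) (k : nat) (e : expr)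
    (X : nat -> nat) : nat -> nat :=
  fun i => if i < L then eval L (set_array A k X) [:: i] e else 0.

Lemma set_array_set A k X Y : set_array (set_array A k X) k Y = set_array A k Y.
Proof. by apply/funext => k'; apply/funext => i; rewrite /set_array; case: eqP. Qed.

Lemma set_array_id A k : set_array A k (A k) = A.
Proof.
by apply/funext => k'; apply/funext => i; rewrite /set_array; case: eqP => [->|].
Qed.

Lemma run_Tab L k e A N : run L (Tab k e) (A, N) =
  (set_array A k (tab_step L A k e (A k)), N).
Proof. by rewrite /tab_step set_array_id. Qed.

Lemma iter_run_Tab L n k e A N : iter n (run L (Tab k e)) (A, N) =
  (set_array A k (iter n (tab_step L A k e) (A k)), N).
Proof.
elim: n => [|n IH]; first by rewrite set_array_id.
rewrite !iterS IH run_Tab set_array_set; congr (set_array _ _ _, _).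
by rewrite /tab_step set_array_set /set_array eqxx.
Qed.

Lemma iter_run_NTab L n e A N : iter n (run L (NTab e)) (A, N) =
  (A, iter n (fun N i => if i < L then neval L A N [:: i] e else 0) N).
Proof. by elim: n => //= n ->. Qed.

(** * Correctness of the algorithm *)

Lemma iteri_ext T n (f g : nat -> T -> T) x0 :
  (forall i y, i < n -> f i y = g i y) -> iteri n f x0 = iteri n g x0.
Proof.
elim: n => [//|n IH] fg /=; rewrite fg // IH // => i y lt.
by apply: fg; apply: ltnW.
Qed.

Lemma eval_Ite L A rho e1 e2 e3 : eval L A rho (Ite e1 e2 e3) =
  if eval L A rho e1 != 0 then eval L A rho e2 else eval L A rho e3.
Proof. by []. Qed.

Lemma run_CSeq L p1 p2 AN : run L (CSeq p1 p2) AN = run L p2 (run L p1 AN).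
Proof. by case: AN. Qed.

Lemma run_Repeat L p AN : run L (Repeat p) AN = iter L (run L p) AN.
Proof. by case: AN. Qed.

Lemma run_Repeat2 L p AN : run L (Repeat (Repeat p)) AN = iter (L * L) (run L p) AN.
Proof.
by rewrite run_Repeat iterM; apply: eq_iter => AN'; rewrite run_Repeat.
Qed.

Lemma tab_step_set L A k e X : tab_step L (set_array A k X) k e = tab_step L A k e.
Proof. by apply/funext => Y; rewrite /tab_step set_array_set. Qed.

Section Correctness.
Variables (S : signature) (x : seq (term S * term S) * term S).

Let L := size (positions x).
Let V (i : nat) : bool := 0 < i < L.

Let A0 : nat -> nat -> nat := arr L (nth 0 (encode_input x)).

Lemma input_array_code (A : nat -> nat -> nat) i : A 0 = A0 0 -> V i ->
  A 0 i = enum_rank (root_symbol (node x i)).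
Proof.
move=> -> Vi; rewrite /A0 /arr; have /andP[_ ->] := Vi.
by rewrite double0 mul0n encode_input_code.
Qed.

Lemma input_array_size (A : nat -> nat -> nat) : A 0 = A0 0 -> A 0 0 = size x.1.
Proof. by move=> ->; rewrite /A0 /arr encode_inputE. Qed.

Lemma eval_Congruent (A : nat -> nat -> nat) rho e1 e2 : A 0 = A0 0 ->
  eval L A rho e1 < L -> eval L A rho e2 < L ->
  (eval L A rho (Congruent S e1 e2) != 0) =
  [&& 0 < eval L A rho e1, 0 < eval L A rho e2
    & `[< congruent (node x) (fun i q => iter q (A 1) i.+1) (A 3)
            (eval L A rho e1) (eval L A rho e2) >]].
Proof.
move=> HA; rewrite /Congruent !eval_And.
case: (posnP (eval L A rho e1)) => [->//|i0] iL.
case: (posnP (eval L A rho e2)) => [->//|j0] jL; rewrite !andTb.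
have Vi : V (eval L A rho e1) by rewrite /V i0.
have Vj : V (eval L A rho e2) by rewrite /V j0.
have Ci := input_array_code HA Vi; have Cj := input_array_code HA Vj.
rewrite (eval_Case _ Ci) eval_all eval_Eq [eval L A rho (Sym e1)]/= Ci.
rewrite [eval L A rho (Sym e2)]/= Cj (inj_eq val_inj) (inj_eq enum_rank_inj) eqb0 negbK.
apply/andP/asboolP => [[/eqP ss /allP H]|[ss H]]; split=> //.
- move=> q qf; have := H q; rewrite mem_iota qf eval_Eq eqb0 negbK => /(_ isT)/eqP.
  by rewrite /= !eval_Child.
- by rewrite ss.
apply/allP => q; rewrite mem_iota => /andP[_ qf].
by rewrite eval_Eq eqb0 negbK /= !eval_Child H.
Qed.

Lemma eval_Equation (A : nat -> nat -> nat) rho m n : A 0 = A0 0 ->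
  (eval L A rho (Equation m n) != 0) =
  has (fun k => [&& k < size x.1, A 2 (k + k) == nth L rho m
                 & A 2 (k + k + 1) == nth L rho n]) (iota 0 L).
Proof.
move=> HA; rewrite (@eval_Exists _ _ _ _ (fun k => [&& k < size x.1,
  A 2 (k + k) == nth L rho m & A 2 (k + k + 1) == nth L rho n])).
  by rewrite eqb0 negbK.
move=> k acc kL; rewrite !eval_And eval_Lt !eval_Eq /= !eqb0 !negbK.
by rewrite (input_array_size HA).
Qed.

(** * Positions of arguments and of input terms *)

Let E : nat -> nat := iter L (tab_step L A0 1 (end_step S)) (A0 1).

Let ch (i q : nat) : nat := iter q E i.+1.

Lemma E_correct i : V i -> E i = i + size (subterms (node x i)).
Proof.
apply: (@ends_correct _ x (fun r => iter r (tab_step L A0 1 (end_step S)) (A0 1))).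
move=> r j Vj; rewrite iterS {1}/tab_step; have /andP[_ ->] := Vj.
rewrite /end_step (eval_Case _ (f := root_symbol (node x j))) ?eval_Child //.
exact: input_array_code.
Qed.

Lemma ch_correct i (f : S) (a : {ffun 'I_(arity f) -> term S}) :
  V i -> node x i = App a -> forall q : 'I_(arity f), V (ch i q) /\ node x (ch i q) = a q.
Proof.
move=> Vi Ei; apply: (proj2 (walk_args (E := E) Vi Ei _)) => j Vj _.
exact: E_correct.
Qed.

Lemma ch_position i q : V i -> q < arity (root_symbol (node x i)) -> V (ch i q).
Proof.
move=> Vi qi; have [b Eb] := root_symbolP (erefl (root_symbol (node x i))).
by have [] := ch_correct Vi Eb (Ordinal qi).
Qed.

Let A1 := set_array A0 1 E.
Let RT : nat -> nat := iter L (tab_step L A1 2 root_step) (A1 2).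

(** Entry [j] is right from round [j.+1] on, being computed from entry [j - 1] of the previous
    round. *)
Lemma RT_iter k : k < L -> RT k = iter k E 1.
Proof.
suff H r j : j < r -> j < L -> iter r (tab_step L A1 2 root_step) (A1 2) j = iter j E 1.
  by move=> kL; apply: H.
elim: r j => [//|r IH] j jr jL; rewrite iterS {1}/tab_step jL /=.
by case: j jr jL => //= j jr jL; rewrite {2}/set_array /= subSS subn0 IH //; lia.
Qed.

Lemma RT_correct k : k < size (input_terms x) ->
  V (RT k) /\ node x (RT k) = nth x.2 (input_terms x) k.
Proof.
move=> kI; rewrite RT_iter; first by apply: walk_roots => // i; apply: E_correct.
exact: ltn_trans (size_input_terms_positions x).
Qed.

(** * Propagation of labels *)

Let A2 := set_array A1 2 RT.

Definition linked (X : nat -> nat) (j i : nat) : bool :=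
  [|| [&& 0 < j, 0 < i & `[< congruent (node x) ch X j i >]],
      has (fun k => [&& k < size x.1, RT (k + k) == j & RT (k + k + 1) == i]) (iota 0 L)
    | has (fun k => [&& k < size x.1, RT (k + k) == i & RT (k + k + 1) == j]) (iota 0 L)].

Let lstep := tab_step L A2 3 (label_step S).

Lemma lstepE X i : i < L -> lstep X i =
  iteri L (fun j acc => if (X j < acc) && linked X j i then X j else acc) (X i).
Proof.
move=> iL; rewrite /lstep /tab_step iL /label_step.
set A := set_array A2 3 X; have HA : A 0 = A0 0 by [].
transitivity (iteri L (fun j acc => eval L A [:: j; acc; i] (Ite
    (And (Lt (Label (Var 0)) (Var 1))
      (Or (Congruent S (Var 0) (Var 2)) (Or (Equation 0 2) (Equation 2 0))))
    (Label (Var 0)) (Var 1))) (X i)); first by [].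
apply: iteri_ext => j acc jL; rewrite eval_Ite eval_And eval_Lt !eval_Or.
by rewrite eval_Congruent // !eval_Equation.
Qed.

Lemma lstep_le X i : lstep X i <= X i.
Proof.
have [iL|Li] := ltnP i L; last by rewrite /lstep /tab_step ltnNge Li.
by rewrite lstepE //; case: (iteri_min L X (linked X ^~ i) (X i)).
Qed.

Let R0 : nat -> nat := fun i => if i < L then i else 0.
Let R := iter (L * L) lstep R0.

(** Labels start as positions below [L], so their sum is at most [L * L], the number of rounds. *)
Lemma R_fixpoint : lstep R = R.
Proof.
apply: (@iter_fixpoint L); first exact: lstep_le.
  by move=> i Li; rewrite /R0 ltnNge Li.
have -> : L * L = \sum_(i < L) L by rewrite sum_nat_const card_ord.
apply: leq_sum => i _.
by rewrite /R0 ltn_ord ltnW.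
Qed.

Lemma linkedC X i j : linked X i j = linked X j i.
Proof.
suff H k l : linked X k l -> linked X l k by apply/idP/idP; apply: H.
case/or3P => [/and3P[k0 l0 /asboolP[ss H]]|h|h]; apply/or3P.
- apply: Or31; rewrite k0 l0; apply/asboolP; split=> // q; rewrite -ss => qf.
  by rewrite H.
- exact: Or33.
- exact: Or32.
Qed.

(** In a stable labelling neither of two linked positions can lower the label of the other. *)
Lemma linked_eq i j : V i -> V j -> linked R i j -> R i = R j.
Proof.
move=> Vi Vj lij; apply/eqP; rewrite eqn_leq; apply/andP; split.
  rewrite -{1}R_fixpoint lstepE; last by case/andP: Vi.
  have [_ H _] := iteri_min L R (linked R ^~ i) (R i).
  by apply: H; [case/andP: Vj|rewrite linkedC].
rewrite -{1}R_fixpoint lstepE; last by case/andP: Vj.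
have [_ H _] := iteri_min L R (linked R ^~ j) (R j).
by apply: H => //; case/andP: Vi.
Qed.

Lemma equation_positions k : k < size x.1 ->
  [/\ V (RT (k + k)), V (RT (k + k + 1)) &
    (node x (RT (k + k)), node x (RT (k + k + 1))) = nth (x.2, x.2) x.1 k].
Proof.
move=> km; have sI := size_input_terms x; rewrite addn1 addnn.
have [|V1 ->] := @RT_correct k.*2; first by lia.
have [|V2 ->] := @RT_correct k.*2.+1; first by lia.
by split=> //; apply: nth_input_terms.
Qed.

Lemma equation_linked X k : k < size x.1 -> linked X (RT (k + k)) (RT (k + k + 1)).
Proof.
move=> km; apply/orP; right; apply/orP; left; apply/hasP; exists k.
  rewrite mem_iota /= add0n; have := size_input_terms_positions x.
  by rewrite size_input_terms -/L; lia.
by rewrite km !eqxx.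
Qed.

Lemma linked_derivable X i j :
  (forall i, V i -> V (X i) /\ derivable x.1 (node x i) (node x (X i))) ->
  V i -> j < L -> linked X j i -> V j /\ derivable x.1 (node x i) (node x j).
Proof.
move=> HX Vi jL; case/or3P=> [/and3P[j0 i0 /asboolP C]|/hasP[k _]|/hasP[k _]].
- have Vj : V j by rewrite /V j0.
  by split=> //; apply: derivable_sym; apply: (congruent_derivable ch_correct HX).
- move=> /and3P[km /eqP <- /eqP <-]; have [V1 V2 Ek] := equation_positions km.
  by split=> //; apply/derivable_sym/derivable_ax; rewrite Ek mem_nth.
- move=> /and3P[km /eqP <- /eqP <-]; have [V1 V2 Ek] := equation_positions km.
  by split=> //; apply: derivable_ax; rewrite Ek mem_nth.
Qed.

(** Soundness is an invariant of the rounds: a new label is that of a linked position, which is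
    equivalent by [linked_derivable]. *)
Lemma R_correct i : V i -> V (R i) /\ derivable x.1 (node x i) (node x (R i)).
Proof.
rewrite /R; elim: (L * L) i => [|n IH] i Vi.
  by rewrite /= /R0; have /andP[_ ->] := Vi; split=> //; apply: derivable_refl.
rewrite iterS lstepE; last by case/andP: Vi.
set X := iter n lstep R0 in IH *.
have [_ _ [->|[j [jL lji ->]]]] := iteri_min L X (linked X ^~ i) (X i); first exact: IH.
have [Vj D] := linked_derivable IH Vi jL lji; have [VXj DX] := IH j Vj.
by split=> //; apply: derivable_trans DX.
Qed.

Lemma R_congruent i j : V i -> V j -> congruent (node x) ch R i j -> R i = R j.
Proof.
move=> Vi Vj C; apply: linked_eq => //; apply/orP; left.
case/andP: Vi => -> _; case/andP: Vj => -> _; exact/asboolP.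
Qed.

Lemma R_equation p q : (p, q) \in x.1 ->
  exists i j, [/\ V i, V j, node x i = p, node x j = q & R i = R j].
Proof.
move=> pq; have km : index (p, q) x.1 < size x.1 by rewrite index_mem.
have [V1 V2] := equation_positions km; rewrite nth_index // => -[E1 E2].
exists (RT (index (p, q) x.1 + index (p, q) x.1)).
exists (RT (index (p, q) x.1 + index (p, q) x.1 + 1)); split=> //.
by apply: linked_eq => //; apply: equation_linked.
Qed.

(** * Classes with elements of large height *)

Let A3 := set_array A2 3 R.
Let hstep := tab_step L A3 4 (high_step S).
Let H0 : nat -> nat := fun i => if i < L then 1 else 0.

Lemma hstepE X i : i < L -> hstep X i = (X i != 0) &&
  has (fun j => [&& 0 < j, R j == R i &
    has (fun q => X (ch j q) != 0) (iota 0 (arity (root_symbol (node x j))))])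
    (iota 0 L).
Proof.
move=> iL; rewrite /hstep /tab_step iL /high_step.
set A := set_array A3 4 X; have HA : A 0 = A0 0 by [].
rewrite {1}/And eval_Ite [eval L A [:: i] (High _)]/=.
case: (X i != 0) => //; apply: eval_Exists => j acc jL.
rewrite !eval_And eval_Eq [eval L A _ (Var 0)]/= -lt0n.
case: posnP => //= j0; rewrite eqb0 negbK; congr andb.
have Vj : V j by rewrite /V j0.
rewrite (eval_Case _ (f := root_symbol (node x j))); last exact: input_array_code.
by rewrite eval_has; apply: eq_has => q; rewrite [High _]lock -lock /= eval_Child.
Qed.

Lemma hstep_le X i : hstep X i <= X i.
Proof.
have [iL|Li] := ltnP i L; last by rewrite /hstep /tab_step ltnNge Li.
by rewrite hstepE //; case: (X i) => //= n; case: has.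
Qed.

(** Initially all flags are set, rightly so, because [node x i] itself has positive height. *)
Lemma iter_hstep d i : V i -> (iter d hstep H0 i != 0) <->
  exists2 s, evaluates L (node x) ch R s (R i) & d < height s.
Proof.
elim: d i => [|d IH] i Vi.
  have /andP[_ iL] := Vi; rewrite /= /H0 iL; split=> // _.
  exists (node x i); first exact: (evaluates_node ch_correct).
  by case: (node x i).
have iL : i < L by case/andP: Vi.
rewrite iterS hstepE // eqb0 negbK (high_evaluates_step ch_correct) //.
split=> [/andP[_ /hasP[j]]|[j [q [Vj Rj qj Hjq]]]].
  rewrite mem_iota => /andP[_ jL] /and3P[j0 /eqP Rj /hasP[q]].
  rewrite mem_iota => /andP[_ qj] hq.
  have Vj : V j by rewrite /V j0.
  by exists j, q; split=> //; apply/IH => //; apply: ch_position.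
apply/andP; split.
  apply/IH => //; have : exists2 s, evaluates L (node x) ch R s (R i) & d.+1 < height s.
    by apply/(high_evaluates_step ch_correct) => //; exists j, q.
  by case=> s Es hs; exists s => //; apply: ltnW.
case/andP: (Vj) => j0 jL; apply/hasP; exists j; first by rewrite mem_iota.
rewrite j0 Rj eqxx; apply/hasP; exists q; first by rewrite mem_iota.
by apply/IH => //; apply: ch_position.
Qed.

(** The flags are 0 or 1 and sum to [L] at the start, so they are stable after [L] rounds; a flag
    still set then is set in round [d + L] for every [d]. *)
Lemma high_infinite i : V i -> iter L hstep H0 i != 0 ->
  forall d, exists2 s, evaluates L (node x) ch R s (R i) & d < height s.
Proof.
move=> Vi Hi d.
have fix_L : hstep (iter L hstep H0) = iter L hstep H0.
  apply: (@iter_fixpoint L); first exact: hstep_le.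
    by move=> k Lk; rewrite /H0 ltnNge Lk.
  rewrite (eq_bigr (fun=> 1)); first by rewrite sum_nat_const card_ord muln1.
  by move=> k _; rewrite /H0 ltn_ord.
have : iter (d + L) hstep H0 i != 0.
  rewrite iterD; elim: d => //= d IH.
  by rewrite (iter_fix _ fix_L) in IH *; rewrite fix_L.
case/(iter_hstep _ Vi) => s Es hs; exists s => //.
by apply: leq_ltn_trans hs; apply: leq_addr.
Qed.

(** * Counting elements of bounded height *)

Let A4 := set_array A3 4 (iter L hstep H0).

Lemma eval_Canonical_position i j : j < L ->
  (eval L A4 [:: j; i] (Canonical_position S 0) != 0) =
  `[< canonical L (node x) ch R j >].
Proof.
move=> jL; have HA : A4 0 = A0 0 by [].
rewrite eval_And eval_Not (@eval_Exists _ _ _ _ (fun j' => (j' < j) &&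
  [&& 0 < j', 0 < j & `[< congruent (node x) ch R j' j >]])); last first.
  by move=> j' acc j'L; rewrite eval_And eval_Lt eval_Congruent.
rewrite [eval _ _ _ (Var 0)]/= -lt0n eqb0.
apply/andP/asboolP => [[j0 /hasP H]|[Vj H]].
  split; first by rewrite j0.
  move=> j' /andP[j'0 j'j] C; apply: H; exists j'.
    by rewrite mem_iota /= (ltn_trans j'j).
  by rewrite j'j j'0 j0; apply/asboolP.
split; first by case/andP: Vj.
apply/hasP => -[j' _ /and4P[j'j j'0 _ /asboolP C]].
by apply: (H j') => //; rewrite j'0.
Qed.

Let nstep (N : nat -> nat) : nat -> nat :=
  fun i => if i < L then neval L A4 N [:: i] (count_step S) else 0.

Lemma nstepE N i : i < L -> nstep N i =
  \sum_(j < L) if `[< canonical L (node x) ch R j >] && (R j == R i)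
    then \prod_(q < arity (root_symbol (node x j))) N (ch j q) else 0.
Proof.
move=> iL; rewrite /nstep iL /count_step.
apply: eq_bigr => j _.
transitivity (if eval L A4 [:: (j : nat); i] (And (Canonical_position S 0)
      (Eq (Label (Var 0)) (Label (Var 1)))) != 0
  then neval L A4 N [:: (j : nat); i] (@NCase S (Var 0) (fun f =>
    foldr (fun q e => NMul (NArr (Child q (Var 0))) e) (NLit 1) (iota 0 (arity f))))
  else 0); first by [].
rewrite eval_And eval_Canonical_position // eval_Eq eqb0 negbK.
rewrite [eval _ _ _ (Label (Var 0))]/= [eval _ _ _ (Label (Var 1))]/=.
case: asboolP => //= -[Vj _].
rewrite (@neval_NCase _ _ _ _ _ _ _ (root_symbol (node x j))); last first.
  exact: input_array_code.
rewrite neval_prod -(big_mkord xpredT (fun q => N (ch j q))) /index_iota subn0.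
case: ifP => // _; apply: eq_bigr => q _.
by rewrite [LHS]/= eval_Child.
Qed.

Lemma iter_nstep d i : V i ->
  card_is (fun s => evaluates L (node x) ch R s (R i) /\ height s <= d)
    (iter d nstep (fun=> 0) i).
Proof.
elim: d i => [|d IH] i Vi; first exact: card_evaluates0.
rewrite iterS nstepE; last by case/andP: Vi.
exact: (card_evaluates_step ch_correct R_congruent x.2 Vi IH).
Qed.

(** An unset flag after [L] rounds means that no element is higher than [L], so the count of
    elements of height at most [L] is complete. *)
Lemma size_correct (i := RT (size x.1).*2) :
  has_size (congruence_class x.1 x.2)
    (if iter L hstep H0 i == 0 then Some (iter L nstep (fun=> 0) i) else None).
Proof.
have [|Vi Ei] := @RT_correct (size x.1).*2; first by rewrite size_input_terms.
rewrite last_input_terms in Ei; rewrite -Ei.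
have cE := congruence_class_evaluates ch_correct R_correct R_congruent R_equation.
case: ifP => [/eqP H|/negbT H].
  apply: has_size_card; apply: card_is_iff (iter_nstep L Vi) => s; rewrite cE //.
  split=> [[]//|Es]; split=> //; rewrite leqNgt; apply/negP => hs.
  by have /(iter_hstep L Vi) : exists2 s, evaluates L (node x) ch R s (R i) & L < height s;
    [exists s|rewrite H].
apply: infinite_height => d.
have [s Es hs] := high_infinite Vi H d.
by exists s => //; apply/cE.
Qed.

Lemma algorithm_correct (AN := run L (algorithm S) (A0, narr L (fun=> 0))) :
  has_size (congruence_class x.1 x.2)
    (if eval L AN.1 [::] (High target) == 0 then Some (AN.2 0) else None).
Proof.
have [|Vi _] := @RT_correct (size x.1).*2; first by rewrite size_input_terms.
have N0 : narr L (fun=> 0) = fun=> 0 by apply/funext => i; rewrite /narr if_same.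
(* Executing the commands in order produces the tables [E], [RT], [R], the flags and the counts
   studied above. *)
have -> : AN = (A4, fun i => if i < L then neval L A4 (iter L nstep (fun=> 0)) [:: i]
    (NArr target) else 0).
  rewrite /AN N0 /algorithm !run_CSeq run_Repeat2 !run_Repeat iter_run_Tab.
  rewrite -/E -/A1 iter_run_Tab -/RT -/A2 run_Tab.
  rewrite iter_run_Tab tab_step_set set_array_set -/lstep.
  rewrite -[iter (L * L) _ _]/R -/A3 run_Tab iter_run_Tab tab_step_set.
  by rewrite set_array_set -/hstep -[iter L hstep _]/(iter L hstep H0) -/A4
    iter_run_NTab.
have tE : eval L A4 [::] target = RT (size x.1).*2.
  have w0 : A0 0 0 = size x.1 by apply: input_array_size.
  by rewrite -[LHS]/(RT (A0 0 0 + A0 0 0)) w0 addnn.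
rewrite [eval _ _ _ (High _)]/(iter L hstep H0 (eval L A4 [::] target)) tE.
rewrite [X in Some X]/(iter L nstep (fun=> 0) (eval L A4 [::] target)) tE.
exact: size_correct.
Qed.

End Correctness.

Theorem theorem3p8 (S : signature) :
  polynomial_time (@encode_input S)
    (fun x => equations_size x.1 + term_size x.2)
    (fun x n => has_size (congruence_class x.1 x.2) n).
Proof.
have [b1 pb1 H1] := ccompile_correct (algorithm S).
have [b2 pb2 H2] := compile_correct (High target).
have [C [k Ck]] : polynomially_bounded (fun L => b1 L + (b2 L + 3)) by poly_bound.
(* The flag is computed in register 1 and moved to register 0 only at the end, since register 0
   holds the input length until then. The closing block costs 3 steps. *)
exists (Seq (ccompile 1 (algorithm S)) (Seq (compile [::] 1 (High target))
  (block [:: Const 0 0; Add 0 0 1]))), C, k => x.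
have sL := size_encode_input x.
have [r1 [m1 [c1 [run1 ag1 E1]]]] := H1 (size (positions x)) 1
  (upd (fun=> 0) 0 (size (encode_input x))) (nth 0 (encode_input x)) (fun=> 0) sL isT.
have [|r2 [run2 ag2 E2]] := H2 (size (positions x)) [::] 1 r1 m1 c1 _ isT isT.
  by rewrite ag1.
have run3 := @runs_block [:: Const 0 0; Add 0 0 1] (State r2 m1 c1).
have [T leT ex] := runs_Seq run1 (runs_Seq run2 run3).
exists T; eexists; split; first exact: ex.
  (* The input has exactly one word more than its measure, so a bound in [L] is a bound in the
     successor of the measure. *)
  by apply: leq_trans leT _; rewrite -size_encode_measure sL; apply: Ck.
have := algorithm_correct x; rewrite -E1 /output /= updE add0n.
by rewrite updN // E2.
Qed.
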